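(* For $f\in\mathcal{D}_{+}\cap C^{3}$ with distribution function $F$ let $R_{f}=\{F,x\}/f(x)^{2}$ on the interior of the support. The equations $R_{f}\equiv\kappa$ for $\kappa\in\{-2\pi^{2},0,+2\pi^{2}\}$ have the following complete solution families. Elliptic case (uniformizing function $\tan$): $R_{f}\equiv-2\pi^{2}$ $\iff$ $\tan(\pi(F-\tfrac12))$ is Möbius in $x$ $\iff$ $f$ is the density of $\mathrm{Cauchy}(m,\gamma)$ for some $m\in\mathbb{R}$, $\gamma>0$. Parabolic case (uniformizing function the identity): $R_{f}\equiv0$ $\iff$ $F$ is Möbius in $x$ $\iff$ $F$ is an increasing Möbius map of the support onto $(0,1)$. Hyperbolic case (uniformizing function $\tanh$): $R_{f}\equiv+2\pi^{2}$ $\iff$ $\tanh(\pi(F-\tfrac12))$ is Möbius in $x$ $\iff$ $\tanh(\pi(F-\tfrac12))=h$ with $h$ a Möbius map of the support onto $(-\tanh\tfrac{\pi}{2},\tanh\tfrac{\pi}{2})$. Up to affine equivalence, the zero-curvature laws ($R_f\equiv0$) are the uniform law, the Lomax law with density $(1+x)^{-2}$ on $(0,\infty)$ and its reflection, and the truncated family $$f_{c}(x)=\frac{1+c}{(1+cx)^{2}}\,\mathbf{1}_{(0,1)}(x),\qquad c>-1;$$ the laws with $R_f\equiv+2\pi^{2}$ are supported on bounded intervals or half-lines, with symmetric representatives $$f(x)=\frac{1}{\pi\gamma\big(1-(x-m)^{2}/\gamma^{2}\big)}\qquad\text{on }|x-m|<\gamma\tanh\tfrac{\pi}{2}.$$ The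 uniformizing functions $\tan,\mathrm{id},\tanh$ correspond to the elliptic, parabolic and hyperbolic classes of $\mathrm{SL}(2,\mathbb{R})$.
   Context: $\mathcal{D}_{+}$ is the set of probability densities on $\mathbb{R}$ that are continuous and strictly positive on an open interval (the support, bounded or not) and vanish outside it; the $C^{3}$ condition is on that open interval. $\{F,x\}=\frac{F'''}{F'}-\frac32\big(\frac{F''}{F'}\big)^{2}$ is the Schwarzian derivative. A function is Möbius in $x$ if it equals $\frac{ax+b}{cx+d}$ with $ad-bc\neq0$ on the open support interval. $\mathrm{Cauchy}(m,\gamma)$ has density $\frac{\gamma}{\pi[(x-m)^{2}+\gamma^{2}]}$. Affine equivalence of laws is via increasing affine changes of variable. *)

(* Defs.v *)
From HB Require Import structures.
From mathcomp Require Export all_boot all_order all_algebra.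
From mathcomp Require Export all_classical all_reals all_analysis.

Set Implicit Arguments.
Unset Strict Implicit.
Unset Printing Implicit Defensive.

Import Order.TTheory GRing.Theory Num.Theory.
Import numFieldNormedType.Exports.

Local Open Scope classical_set_scope.
Local Open Scope ring_scope.

Section Laws.
Context {R : realType}.
Implicit Types (f g : R -> R) (S : set R).

Definition law f : set (measurableTypeR R) -> \bar R :=
  fun A => (\int[lebesgue_measure]_(x in A) (f x)%:E)%E.

Definition cdf_of f : R -> R := fun x => fine (law f `]-oo, x]).

Definition supp f : set R := [set x | f x != 0].

(* Measurability of [f] is not listed: it follows from continuity on the open
   set [supp f], off which [f] is zero. Non-emptiness of the support follows
   from the total mass. *)
Definition Dplus f : Prop :=
  [/\ open (supp f), is_interval (supp f),
      forall x, supp f x -> 0 < f x,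
      forall x, supp f x -> {for x, continuous f}
    & law f setT = 1%E].

(* Meant for open [S]: [derive1n] is the total iterated derivative, which near a
   point of [S] depends only on the restriction of [f] to [S]. *)
Definition C3_on S f : Prop :=
  (forall k x, (k < 3)%N -> S x -> derivable (derive1n k f) x 1) /\
  (forall k x, (k <= 3)%N -> S x -> {for x, continuous (derive1n k f)}).

Definition schwarzian g (x : R) : R :=
  derive1n 3 g x / derive1n 1 g x
  - 3 / 2 * (derive1n 2 g x / derive1n 1 g x) ^+ 2.

Definition Rcurv f (x : R) : R := schwarzian (cdf_of f) x / f x ^+ 2.

Definition Rcurv_const f (kappa : R) : Prop :=
  forall x, supp f x -> Rcurv f x = kappa.

Definition mobius (a b c d x : R) : R := (a * x + b) / (c * x + d).

(* Division by zero being total, regularity of the map on [S] is required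
   explicitly. *)
Definition mobius_on S (h : R -> R) : Prop :=
  exists a b c d : R, a * d - b * c != 0 /\
    forall x, S x -> c * x + d != 0 /\ h x = mobius a b c d x.

Definition increasing_on S (h : R -> R) : Prop :=
  forall x y, S x -> S y -> x < y -> h x < h y.

Definition tanh (x : R) : R :=
  (expR x - expR (- x)) / (expR x + expR (- x)).

Definition cauchy_density (m gamma x : R) : R :=
  gamma / (pi * ((x - m) ^+ 2 + gamma ^+ 2)).

Definition uniform_density (x : R) : R := \1_(`]0, 1[%classic) x.

Definition lomax_density (x : R) : R :=
  (1 + x) ^- 2 * \1_(`]0, +oo[%classic) x.

Definition reflect g (x : R) : R := g (- x).

Definition truncated_density (c x : R) : R :=
  (1 + c) / (1 + c * x) ^+ 2 * \1_(`]0, 1[%classic) x.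

Definition hyperbolic_density (m gamma x : R) : R :=
  if `|x - m| < gamma * tanh (pi / 2)
  then (pi * gamma * (1 - (x - m) ^+ 2 / gamma ^+ 2))^-1 else 0.

Definition symmetric_about (m : R) f : Prop :=
  forall t, f (m + t) = f (m - t).

(* The law with density [g] is that of [a X + b], [X] having density [f]. *)
Definition affine_equiv f g : Prop :=
  exists a b : R, 0 < a /\
    forall A : set (measurableTypeR R), measurable A ->
      law g A = law f ((fun x => a * x + b) @^-1` A).

Definition bounded_interval_or_half_line S : Prop :=
  (exists a b : R, a < b /\ S = `]a, b[%classic) \/
  (exists a : R, S = `]a, +oo[%classic \/ S = `]-oo, a[%classic).

Definition elliptic (A : 'M[R]_2) : Prop := `|\tr A| < 2.
Definition parabolic (A : 'M[R]_2) : Prop :=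
  `|\tr A| = 2 /\ A <> 1%:M /\ A <> - 1%:M.
Definition hyperbolic (A : 'M[R]_2) : Prop := 2 < `|\tr A|.

Definition one_parameter_SL2 (A : R -> 'M[R]_2) : Prop :=
  [/\ forall t, \det (A t) = 1,
      forall s t, A (s + t) = A s *m A t
    & forall i j, continuous (fun t => A t i j)].

(* [phi], with domain [D], turns translations [x |-> x + t] into the Moebius
   action of a one-parameter subgroup of SL(2,R), all of whose non-central
   elements are of class [cls]. The matrix [A t] is determined by [phi] up to
   sign, so the class is an invariant of [phi]. *)
Definition uniformizes_class (phi : R -> R) (D : set R)
    (cls : 'M[R]_2 -> Prop) : Prop :=
  exists A : R -> 'M[R]_2,
    [/\ one_parameter_SL2 A,
        exists t, cls (A t),
        forall t, A t = 1%:M \/ A t = - 1%:M \/ cls (A t)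
      & forall t x, D x -> D (x + t) ->
          A t 1 0 * phi x + A t 1 1 != 0 /\
          phi (x + t) =
            mobius (A t 0 0) (A t 0 1) (A t 1 0) (A t 1 1) (phi x)].

End Laws.

(* Main.v *)
Require Import Defs.
From HB Require Import structures.
From mathcomp Require Import measurable_realfun.
From mathcomp Require Import ring lra.
Import Order.TTheory GRing.Theory Num.Theory.
Import numFieldNormedType.Exports.
Local Open Scope classical_set_scope.
Local Open Scope ring_scope.

(** The Schwarzian derivative satisfies [{T o F, x} = {T, F} F'^2 + {F, x}], it
vanishes exactly on Moebius maps, and the functions [tan (pi p)], [p] and
[tanh (pi p)] have constant Schwarzian [2 pi^2], [0] and [- 2 pi^2]. So the
curvature of [f] has the opposite constant value if and only if [T o F] is a
Moebius map, [T] being the corresponding uniformizing function.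

The proof replaces this calculus by a linear one. The function [T] is a quotient
[S / C] of two solutions of [y'' = - q y], with [q] equal to [pi^2], [0] or
[- pi^2], and the equation [Rcurv f = - 2 q] is [w'' = q f^2 w] for
[w = f^(-1/2)]. It follows that [(S o F) w] and [(C o F) w] are affine
([oscillator_affine]); their quotient is [T o F], and their Wronskian is the
determinant of the Moebius map ([Rcurv_const_mobius]). Conversely,
differentiating the identity between [T o F] and a Moebius map gives an explicit
formula for [f] ([mobius_density]), from which the curvature is computed
([mobius_Rcurv_const]).

The description of the families rests on a property of distribution functions:
[F] maps the support increasingly onto [(0, 1)] ([cdf_of_onto]), and it is the
only primitive of [f] that does so ([cdf_of_primitive_unique]); moreover every
positive continuous function on an open interval with such a primitive is a
density ([Dplus_of_primitive]), which yields the explicit laws. The Moebius map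
[h = T o F] therefore has a known image: [R], [(0, 1)] or
[(- tanh (pi / 2), tanh (pi / 2))]. If [h = (a x + b) / (c x + d)] with [c] not
zero, it omits the value [a / c] ([mobius_omits]). In the elliptic case [h] is
onto [R], so [c = 0] and the law is a Cauchy law ([elliptic_cauchy]). In the
parabolic case the position of [a / c] with respect to [0] and [1] separates the
Lomax law, its reflection and the truncated laws ([parabolic_classification]);
affine equivalence is there checked on distribution functions only
([affine_equiv_of_cdf]). In the hyperbolic case the image is bounded, which
excludes the whole line as a support, while suitable Moebius maps give all the
other open intervals ([hyperbolic_supports]); symmetry of the law makes [h] odd
about the centre, hence affine ([hyperbolic_symmetric]). Finally, the addition
formulas of [tan], [id] and [tanh] exhibit the three one-parameter subgroups of
SL(2,R). *)

Set Implicit Arguments.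
Unset Strict Implicit.

(** * Calculus on open intervals *)

Section Calculus.
Context {R : realType}.
Implicit Types (I : set R) (f g df : R -> R).

Lemma is_derive_continuous f (x d : R) :
  is_derive x 1 f d -> {for x, continuous f}.
Proof. by case=> + _; move/derivable1_diffP/differentiable_continuous. Qed.

Lemma interval_MVT I f df : is_interval I ->
  (forall x, I x -> is_derive x 1 f (df x)) ->
  forall a b, I a -> I b -> a < b ->
  exists2 c, I c & f b - f a = df c * (b - a).
Proof.
move=> itvI fdf a b Ia Ib ab.
have sub x : x \in `[a, b] -> I x.
  by rewrite in_itv/= => /(itvI a b Ia Ib).
have [||c cab ->] := @MVT R f df a b ab; last 1 first.
- by exists c => //; apply: sub; exact: subset_itv_oo_cc.
- by move=> x xab; apply: fdf; apply: sub; exact: subset_itv_oo_cc.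
apply: continuous_in_subspaceT => x /[1!inE]/= /sub Ix.
exact: is_derive_continuous (fdf _ Ix).
Qed.

Lemma derive_gt0_increasing I f df : is_interval I ->
  (forall x, I x -> is_derive x 1 f (df x)) -> (forall x, I x -> 0 < df x) ->
  increasing_on I f.
Proof.
move=> itvI fdf df0 x y Ix Iy xy; rewrite -subr_gt0.
have [c Ic ->] := interval_MVT itvI fdf Ix Iy xy.
by rewrite mulr_gt0 ?subr_gt0 ?df0.
Qed.

Lemma derive0_constant I f : is_interval I ->
  (forall x, I x -> is_derive x 1 f 0) -> forall x y, I x -> I y -> f x = f y.
Proof.
move=> itvI f0 x y; wlog xy : x y / x < y.
  move=> H Ix Iy; have [xy|yx|->//] := ltgtP x y; first exact: H.
  by rewrite (H y x).
move=> Ix Iy; have [c _ /eqP] := interval_MVT itvI f0 Ix Iy xy.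
by rewrite mul0r subr_eq0 => /eqP.
Qed.

(** The conclusion also names the slope: the value of [df] is needed to
evaluate Wronskians. *)
Lemma derive2_0_affine I f df : is_interval I ->
  (forall x, I x -> is_derive x 1 f (df x)) ->
  (forall x, I x -> is_derive x 1 df 0) ->
  exists a b, forall x, I x -> f x = a * x + b /\ df x = a.
Proof.
move=> itvI fdf df0.
have [[x0 Ix0]|I0] := pselect (exists x, I x); last first.
  by exists 0, 0 => x Ix; case: I0; exists x.
have dfE x : I x -> df x = df x0 by move=> Ix; exact: derive0_constant Ix Ix0.
exists (df x0), (f x0 - df x0 * x0) => x Ix; split; last exact: dfE.
have g0 y : I y -> is_derive y 1 (fun z => f z - df x0 * z) 0.
  move=> Iy; have fy := fdf y Iy.
  apply: is_derive_eq; rewrite dfE//; rewrite /GRing.scale/=; ring.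
have := derive0_constant itvI g0 Ix Ix0; lra.
Qed.

Lemma is_derive_locally_unique I f g (x df dg : R) : open I -> I x ->
  (forall y, I y -> f y = g y) ->
  is_derive x 1 f df -> is_derive x 1 g dg -> df = dg.
Proof.
move=> oI Ix fg [_ <-] [_ <-]; apply: near_eq_derive.
near=> y; apply: fg; near: y; exact: open_nbhs_nbhs.
Unshelve. all: by end_near. Qed.

Lemma is_derive_eq_on I f g (x d : R) : open I -> I x ->
  (forall y, I y -> f y = g y) -> is_derive x 1 f d -> is_derive x 1 g d.
Proof.
move=> oI Ix fg; apply: near_eq_is_derive.
near=> y; apply: fg; near: y; exact: open_nbhs_nbhs.
Unshelve. all: by end_near. Qed.

Lemma open_neighbours I x : open I -> I x ->
  exists e, [/\ 0 < e, I (x - e) & I (x + e)].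
Proof.
move=> oI Ix; have /nbhs_ballP[e /= e0 sub] := open_nbhs_nbhs (conj oI Ix).
have e2 : 0 < e / 2 by rewrite divr_gt0.
have lt_e : `|e / 2| < e by rewrite gtr0_norm// ltr_pdivrMr//; lra.
exists (e / 2); split=> //; apply: sub; rewrite /ball/=.
  by rewrite opprB addrC subrK.
by rewrite opprD addrA subrr add0r normrN.
Qed.

(** The differentiation rules of the library yield scalings [k *: x] and
combinations of functions; the versions from here to [is_derive_affine] are
pointwise and use products of real numbers, so that the derivatives they
compute can be simplified by [ring] and [field]. *)
Lemma is_derive_to f (x d d' : R) :
  is_derive x 1 f d -> d = d' -> is_derive x 1 f d'.
Proof. by move=> ? <-. Qed.

Lemma is_derive_mulr f g (x df dg : R) :
  is_derive x 1 f df -> is_derive x 1 g dg ->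
  is_derive x 1 (fun y => f y * g y) (df * g x + f x * dg).
Proof.
move=> hf hg; apply: (is_derive_to (is_deriveM hf hg)).
by rewrite /GRing.scale/= addrC; congr (_ + _); rewrite mulrC.
Qed.

Lemma is_derive_scaler f (k x df : R) : is_derive x 1 f df ->
  is_derive x 1 (fun y => k * f y) (k * df).
Proof. exact: is_deriveZ. Qed.

Lemma is_derive_invr f (x df : R) : is_derive x 1 f df -> f x != 0 ->
  is_derive x 1 (fun y => (f y)^-1) (- df / f x ^+ 2).
Proof.
move=> hf fx; apply: (is_derive_to (is_deriveV fx hf)).
by rewrite /GRing.scale/= mulrC mulrN mulNr.
Qed.

Lemma is_derive_compr f g (x df dg : R) :
  is_derive (g x) 1 f df -> is_derive x 1 g dg ->
  is_derive x 1 (fun y => f (g y)) (df * dg).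
Proof. exact: is_derive1_comp. Qed.

Lemma is_derive_affine (a b x : R) : is_derive x 1 (fun y => a * y + b) a.
Proof. by apply: is_derive_eq; rewrite /GRing.scale/=; ring. Qed.

End Calculus.

(** * Distribution functions of densities *)

Section LawOfDensity.
Context {R : realType}.
Implicit Types (f g G : R -> R) (I : set R).
Local Notation mu := (@lebesgue_measure R).

Lemma Dplus_ge0 f : Dplus f -> forall x, 0 <= f x.
Proof.
case=> _ _ f0 _ _ x; have [->//|fx] := eqVneq (f x) 0.
exact/ltW/f0.
Qed.

Lemma measurable_open_supp f : open (supp f) ->
  (forall x, supp f x -> {for x, continuous f}) ->
  measurable_fun [set: measurableTypeR R] f.
Proof.
move=> oS cf; have mS : measurable (supp f : set (measurableTypeR R)).
  exact: open_measurable.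
rewrite -(setUv (supp f)); apply/measurable_funU => //.
  exact: measurableC.
split; first by apply: open_continuous_measurable_fun => // x /[1!inE]; exact: cf.
apply: (@eq_measurable_fun _ _ _ _ _ (cst (0 : measurableTypeR R))) => // x.
by rewrite inE /supp/= => /negP; rewrite negbK => /eqP.
Qed.

Lemma Dplus_measurable f : Dplus f ->
  measurable_fun [set: measurableTypeR R] f.
Proof. by case=> oS _ _ cf _; exact: measurable_open_supp. Qed.

(** The proof of [Dplus f] is a parameter so that the structures of measure and
of probability can be attached to this function. *)
Definition Dplus_law f of Dplus f : set (measurableTypeR R) -> \bar R := law f.

Section Measure.
Variable f : R -> R.
Hypothesis Df : Dplus f.

Let law0 : Dplus_law Df set0 = 0%E.
Proof. by rewrite /Dplus_law /law integral_set0. Qed.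

Let law_ge0 A : (0 <= Dplus_law Df A)%E.
Proof. by apply: integral_ge0 => x _; rewrite lee_fin Dplus_ge0. Qed.

Let law_sigma_additive : semi_sigma_additive (Dplus_law Df).
Proof.
move=> /= F mF tF mUF; rewrite /Dplus_law /law/= ge0_integral_bigcup//.
- apply: is_cvg_ereal_nneg_natsum_cond => n _ _.
  by apply: integral_ge0 => x _; rewrite lee_fin Dplus_ge0.
- by apply: measurable_funTS; apply/measurable_EFinP; exact: Dplus_measurable.
- by move=> x _; rewrite lee_fin Dplus_ge0.
Qed.

HB.instance Definition _ := isMeasure.Build _ _ _ (Dplus_law Df)
  law0 law_ge0 law_sigma_additive.

Let law_setT : Dplus_law Df setT = 1%E. Proof. by case: Df. Qed.

HB.instance Definition _ :=
  Measure_isProbability.Build _ _ _ (Dplus_law Df) law_setT.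

End Measure.

Section Cdf.
Variable f : R -> R.
Hypothesis Df : Dplus f.
Local Notation F := (cdf_of f).
Local Notation I := (supp f).

Let f0 := Dplus_ge0 Df.
Let mf := Dplus_measurable Df.
Let f1 : law f setT = 1%E. Proof. by case: Df. Qed.
Let P : probability (measurableTypeR R) R := Dplus_law Df.

Let idR : measurableTypeR R -> R := idfun.
#[local] HB.instance Definition _ :=
  @isMeasurableFun.Build _ _ _ _ idR (@measurable_id _ _ setT).

Lemma cdf_ofE x : cdf_of f x = fine (cdf (idR : {RV P >-> R}) x).
Proof. by []. Qed.

Lemma law_cdf x : law f `]-oo, x] = (F x)%:E.
Proof.
rewrite /cdf_of fineK//; change (P `]-oo, x]%classic \is a fin_num).
exact: fin_num_measure.
Qed.

Lemma cdf_of_le x y : x <= y -> F x <= F y.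
Proof.
by move=> xy; rewrite !cdf_ofE fine_le ?cdf_nondecreasing//; exact: fin_num_measure.
Qed.

Lemma cdf_of_ge0 x : 0 <= F x.
Proof. by rewrite cdf_ofE fine_ge0 ?cdf_ge0. Qed.

Lemma cdf_of_le1 x : F x <= 1.
Proof. by rewrite -lee_fin -law_cdf; exact: (@probability_le1 _ _ _ P). Qed.

Lemma density_integrable (D : set (measurableTypeR R)) : measurable D ->
  mu.-integrable D (EFin \o f).
Proof.
move=> mD; apply: (integrableS measurableT) => //.
apply/integrableP; split; first exact/measurable_EFinP.
under eq_integral do rewrite /= ger0_norm//.
by have := f1; rewrite /law => ->; rewrite ltry.
Qed.

Lemma is_derive_cdf x : I x -> is_derive x 1 F (f x).
Proof.
move=> Ix; case: Df => _ _ _ cf _.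
have xx1 : x < x + 1 by rewrite ltrDl.
have iF := density_integrable (measurable_itv `]-oo, x + 1]).
have [dF dFE] := @continuous_FTC1 R f -oo%O x (x + 1) xx1 iF (ltNyr _) (cf x Ix).
by apply: DeriveDef => //; rewrite -derive1E.
Qed.

(** Up to the constant [F a], the function [F] on [[a, b]] is an integral
depending on its upper bound. *)
Lemma cdf_of_continuous a b : a <= b -> {within `[a, b], continuous F}.
Proof.
move=> ab; have cF := @parameterized_integral_continuous R a b f ab
  (density_integrable (measurable_itv _)).
pose G := (fun x => parameterized_integral mu a x f + F a).
have FG x : x \in `[a, b] -> G x = F x.
  rewrite in_itv/= => /andP[ax _].
  rewrite /G /parameterized_integral -Rintegral_itv_obnd_cbnd; last first.
    exact: density_integrable.
  rewrite -(@Rintegral_itvB _ f -oo%O)//.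
  - by rewrite /cdf_of /law /Rintegral subrK.
  - exact: density_integrable.
apply: (@subspace_eq_continuous _ _ _ G).
  by move=> x /[1!inE]; exact: FG.
move=> x; apply: cvgD; first exact: cF.
exact: cvg_cst.
Qed.

Lemma cdf_of_tails (e : R) : 0 < e ->
  exists2 n : R, 0 <= n & F (- n) < e /\ 1 - e < F n.
Proof.
move=> e0.
have Fy : F x @[x --> +oo] --> (1 : R).
  exact: (fine_cvg (@cvg_cdfy1 _ _ _ P (idR : {RV P >-> R}))).
have FNy : F x @[x --> -oo] --> (0 : R).
  exact: (fine_cvg (@cvg_cdfNy0 _ _ _ P (idR : {RV P >-> R}))).
have e1 : 1 - e < 1 by lra.
have [M1 [_ HM1]] := @cvgr_gt _ _ _ _ _ _ Fy _ e1.
have [M2 [_ HM2]] := @cvgr_lt _ _ _ _ _ _ FNy _ e0.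
pose n := `|M1| + `|M2| + 1.
have h1 := ler_norm M1; have h2 : - M2 <= `|M2| by rewrite -normrN ler_norm.
have p1 := normr_ge0 M1; have p2 := normr_ge0 M2.
exists n; rewrite /n; first lra.
split; [apply: HM2|apply: HM1]; lra.
Qed.

Lemma cdf_of_increasing : increasing_on I F.
Proof.
case: Df => _ itvI f_gt0 _ _.
by apply: (derive_gt0_increasing itvI is_derive_cdf).
Qed.

Lemma cdf_of_in01 x : I x -> 0 < F x < 1.
Proof.
move=> Ix; case: (Df) => oI _ _ _ _.
have [e [e0 I1 I2]] := open_neighbours oI Ix.
have := cdf_of_increasing I1 Ix; have := cdf_of_increasing Ix I2.
have := cdf_of_ge0 (x - e); have := cdf_of_le1 (x + e).
move=> ? ? /(_ ltac:(lra)) ? /(_ ltac:(lra)) ?; apply/andP; split; lra.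
Qed.

Lemma cdf_of_below x : (forall y, I y -> x < y) -> F x = 0.
Proof.
move=> H; rewrite /cdf_of /law integral0_eq// => y /=; rewrite in_itv/= => yx.
case: (eqVneq (f y) 0) => [->//|fy].
by have := H _ fy; rewrite ltNge yx.
Qed.

Lemma cdf_of_above x : (forall y, I y -> y < x) -> F x = 1.
Proof.
move=> H; apply/eqP; rewrite -eqe -law_cdf -f1; apply/eqP.
rewrite /law [LHS]integral_mkcond; apply: eq_integral => y _.
rewrite patchE; case: ifPn => //; rewrite notin_setE/= in_itv/= => /negP.
rewrite -ltNge => xy; case: (eqVneq (f y) 0) => [->//|fy].
by have := H _ fy; rewrite ltNge ltW.
Qed.

Lemma off_supp_cases x : ~ I x ->
  (forall y, I y -> x < y) \/ (forall y, I y -> y < x).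
Proof.
move=> nIx; case: (Df) => _ itvI _ _ _.
have [[y [Iy yx]]|H] := pselect (exists y, I y /\ y <= x).
  right=> z Iz; rewrite ltNge; apply/negP => xz; apply: nIx.
  by apply: (itvI y z) => //; rewrite yx xz.
by left=> y Iy; rewrite ltNge; apply/negP => yx; apply: H; exists y.
Qed.

(** The tails of [F] and its continuity produce a point where [F] takes a given
value of [(0, 1)]; this point is in the support because [F] is constant, equal
to 0 or 1, off the support. *)
Lemma cdf_of_onto : F @` I = `]0, 1[%classic.
Proof.
apply/seteqP; split => [_ [x Ix <-]|p]/=; rewrite in_itv/=.
  exact: cdf_of_in01.
move=> /andP[p0 p1].
have e0 : 0 < Num.min p (1 - p) by rewrite lt_min; lra.
have [n n0 [Fn1 Fn2]] := cdf_of_tails e0.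
have nn : - n <= n by lra.
have lep : F (- n) <= p.
  by apply: ltW; apply: lt_le_trans Fn1 _; rewrite ge_min lexx.
have gep : p <= F n.
  apply: ltW; apply: le_lt_trans Fn2; rewrite lerBrDr -lerBrDl ge_min lexx orbT//.
have [|c _ Fc] := @IVT R F (- n) n p nn (cdf_of_continuous nn).
  by rewrite ge_min lep/= le_max gep orbT.
exists c => //; apply: contrapT.
by move=> /off_supp_cases[/cdf_of_below|/cdf_of_above]; lra.
Qed.

(** Two primitives of [f] on an interval differ by a constant, and no
non-trivial translation maps [(0, 1)] onto itself. This identifies the
distribution function of an explicit density without computing an integral. *)
Lemma cdf_of_primitive_unique G :
  (forall x, I x -> is_derive x 1 G (f x)) -> G @` I = `]0, 1[%classic ->
  forall x, I x -> F x = G x.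
Proof.
move=> dG Gonto x Ix; case: (Df) => _ itvI _ _ _.
have d0 y : I y -> is_derive y 1 (fun z => F z - G z) 0.
  move=> Iy; have := is_derive_cdf Iy; have := dG y Iy => ? ?.
  by apply: is_derive_eq; rewrite subrr.
have FG y : I y -> F y = G y + (F x - G x).
  move=> Iy; have := derive0_constant itvI d0 Iy Ix; lra.
have Ge y : I y -> 0 < G y < 1.
  by move=> Iy; have : (G @` I) (G y) by [exists y]; rewrite Gonto/= in_itv.
(* For k < 0 a point where G = min (-k) (1/2) would have F <= 0; for k > 0 a
   point where G = max (1 - k) (1/2) would have F >= 1. *)
apply/eqP; rewrite -subr_eq0; set k := F x - G x in FG *.
apply/eqP; case: (ltgtP k 0) => // k0.
  have : (`]0, 1[%classic : set R) (Num.min (- k) (1 / 2)).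
    rewrite /= in_itv/= lt_min gt_min; lra.
  rewrite -Gonto => -[y Iy Gy]; have := FG y Iy.
  have /andP[] := cdf_of_in01 Iy; have : G y <= - k by rewrite Gy ge_min lexx.
  lra.
have : (`]0, 1[%classic : set R) (Num.max (1 - k) (1 / 2)).
  rewrite /= in_itv/= lt_max gt_max; lra.
rewrite -Gonto => -[y Iy Gy]; have := FG y Iy.
have /andP[] := cdf_of_in01 Iy; have : 1 - k <= G y by rewrite Gy le_max lexx.
lra.
Qed.

End Cdf.

End LawOfDensity.

(** * Densities from their primitives *)

Section LawConstruction.
Context {R : realType}.
Implicit Types (f g G : R -> R) (I : set R).
Local Notation mu := (@lebesgue_measure R).

Lemma law_setT_supp f I : (forall x, ~ I x -> f x = 0) -> law f setT = law f I.
Proof.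
move=> fI0; rewrite /law [RHS]integral_mkcond; apply: eq_integral => x _.
rewrite patchE; case: ifPn => //; rewrite notin_setE => /fI0 -> //.
Qed.

Lemma law_segment I f G : is_interval I ->
  (forall x, I x -> {for x, continuous f}) ->
  (forall x, I x -> is_derive x 1 G (f x)) ->
  forall a b, I a -> I b -> a < b -> law f `[a, b] = (G b - G a)%:E.
Proof.
move=> itvI cf dG a b Ia Ib ab.
have sub x : x \in `[a, b] -> I x.
  by rewrite in_itv/= => /(itvI a b Ia Ib).
have cG x : I x -> G @ x --> G x.
  by move=> Ix; exact: is_derive_continuous (dG x Ix).
rewrite /law EFinB; apply: (continuous_FTC2 ab).
- apply: continuous_in_subspaceT => x /[1!inE]/= /sub; exact: cf.
- split.
  + move=> x xab; apply: (@ex_derive _ _ _ _ _ _ _ (dG x _)).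
    by apply: sub; exact: subset_itv_oo_cc.
  + exact/cvg_at_right_filter/cG.
  + exact/cvg_at_left_filter/cG.
- move=> x xab; rewrite derive1E.
  by apply: (@derive_val _ _ _ _ _ _ _ (dG x _)); apply/sub/subset_itv_oo_cc.
Qed.

Lemma supp_of_positive_on I g : (forall x, I x -> 0 < g x) ->
  (forall x, ~ I x -> g x = 0) -> supp g = I.
Proof.
move=> g_gt0 g0; apply/seteqP; split => x; rewrite /supp/=.
  by move=> gx; apply: contrapT => /g0 /eqP; apply/negP.
by move/g_gt0/lt0r_neq0.
Qed.

(** The total mass is the limit of the masses [G b - G a] of segments [[a, b]]
that exhaust [I], chosen by the values of [G] at their ends; in this way
bounded and unbounded supports are treated alike. *)
Lemma Dplus_of_primitive I g G : open I -> is_interval I ->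
  (forall x, I x -> 0 < g x) -> (forall x, ~ I x -> g x = 0) ->
  (forall x, I x -> {for x, continuous g}) ->
  (forall x, I x -> is_derive x 1 G (g x)) -> G @` I = `]0, 1[%classic ->
  Dplus g.
Proof.
move=> oI itvI g_gt0 g0 cg dG Gonto.
have suppE : supp g = I by exact: supp_of_positive_on.
split; rewrite ?suppE// (law_setT_supp g0).
have Gmono := derive_gt0_increasing itvI dG g_gt0.
have Gin x : I x -> 0 < G x < 1.
  by move=> Ix; have : (G @` I) (G x) by [exists x]; rewrite Gonto/= in_itv.
(* The ends a n and b n have G-values v n and 1 - v n; starting at 1/3 keeps
   a n < b n for all n. *)
pose v n : R := n.+3%:R^-1.
have n3 n : 0 < v n by rewrite invr_gt0.
have n3' n : v n <= 1 / 3 by rewrite div1r lef_pV2 ?posrE// ler_nat.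
have /choice[a Ha] : forall n, exists x, I x /\ G x = v n.
  move=> n; have : (`]0, 1[%classic : set R) (v n).
    by have := n3 n; have := n3' n; rewrite /= in_itv/=; lra.
  by rewrite -Gonto => -[x Ix Gx]; exists x.
have /choice[b Hb] : forall n, exists x, I x /\ G x = 1 - v n.
  move=> n; have : (`]0, 1[%classic : set R) (1 - v n).
    by have := n3 n; have := n3' n; rewrite /= in_itv/=; lra.
  by rewrite -Gonto => -[x Ix Gx]; exists x.
have leG x y : I x -> I y -> (x <= y) = (G x <= G y).
  move=> Ix Iy; case: (leP x y) => [|xy].
    rewrite le_eqVlt => /predU1P[->|]; first by rewrite lexx.
    by move/(Gmono _ _ Ix Iy)/ltW ->.
  by apply/esym/negbTE; rewrite -ltNge; exact: Gmono.
have ltG x y : I x -> I y -> (x < y) = (G x < G y).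
  by move=> Ix Iy; rewrite !ltNge leG.
have ab n : a n < b n.
  have [Ia Ga] := Ha n; have [Ib Gb] := Hb n; rewrite ltG// Ga Gb.
  have := n3 n; have := n3' n; lra.
pose E n : set (measurableTypeR R) := `[a n, b n]%classic.
have EI : \bigcup_n E n = I.
  apply/seteqP; split => [x [n _]|x Ix].
    rewrite /E/= in_itv/= => /andP[ax xb].
    by apply: (itvI (a n) (b n)); rewrite ?ax ?xb//; [have [] := Ha n|have [] := Hb n].
  have /andP[Gx0 Gx1] := Gin x Ix.
  pose e := Num.min (G x) (1 - G x).
  have e0 : 0 < e by rewrite lt_min; lra.
  pose n := Num.truncn e^-1; exists n => //; rewrite /E/= in_itv/=.
  have ne : v n <= e.
    rewrite /v invf_ple ?posrE//; apply: ltW; apply: lt_trans (truncnS_gt _) _.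
    by rewrite ltr_nat.
  have [Ia Ga] := Ha n; have [Ib Gb] := Hb n.
  rewrite leG// (leG x)// Ga Gb.
  by move: ne; rewrite le_min; lra.
have lawE n : law g (E n) = (1 - v n - v n)%:E.
  have [Ia Ga] := Ha n; have [Ib Gb] := Hb n.
  by rewrite (law_segment itvI cg dG)// Ga Gb.
have mg : measurable_fun [set: measurableTypeR R] g.
  by apply: measurable_open_supp; rewrite suppE.
have cvgI : law g (E n) @[n --> \oo] --> law g I.
  rewrite -EI; apply: ge0_nondecreasing_set_cvg_integral => //.
  - move=> n m nm; apply/subsetPset => x; rewrite /E/= !in_itv/= => /andP[ax xb].
    have [Ia Ga] := Ha n; have [Ib Gb] := Hb n.
    have [Ia' Ga'] := Ha m; have [Ib' Gb'] := Hb m.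
    have mn : v m <= v n :> R by rewrite lef_pV2 ?posrE// ler_nat.
    apply/andP; split.
      by apply: le_trans ax; rewrite leG// Ga Ga'.
    by apply: le_trans xb _; rewrite leG// Gb Gb'; lra.
  - by move=> n; exact: measurable_itv.
  - by move=> n; apply: measurable_funTS; apply/measurable_EFinP.
  - move=> n x Ex; rewrite lee_fin ltW// g_gt0// -EI; by exists n.
have inv0 : v @ \oo --> (0 : R).
  rewrite /v.
  have := @cvg_harmonic R; rewrite /harmonic -(cvg_shiftn 2).
  by under eq_fun do rewrite addnS addn1.
have cvg1 : law g (E n) @[n --> \oo] --> 1%E.
  under eq_fun do rewrite lawE.
  apply: cvg_EFin; first by near=> n.
  rewrite [X in _ --> X](_ : _ = 1 - 0 - 0 :> R); last by rewrite !subr0.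
  by apply: cvgB => //; apply: cvgB => //; exact: cvg_cst.
exact: cvg_unique cvgI cvg1.
Unshelve. all: by end_near. Qed.

End LawConstruction.

(** * Affine equivalence through distribution functions *)

Section Affine.
Context {R : realType}.
Implicit Types (f g G : R -> R) (I : set R).

Lemma measurable_affine (a b : R) :
  measurable_fun [set: measurableTypeR R]
    (fun x : measurableTypeR R => a * x + b : measurableTypeR R).
Proof.
apply: measurable_funD => //; exact: measurable_funM.
Qed.

Lemma affine_preimage (a b x : R) : 0 < a ->
  (fun y => a * y + b) @^-1` `]-oo, x]%classic = `]-oo, (x - b) / a]%classic.
Proof.
move=> a0; apply/seteqP; split => y /=; rewrite !in_itv/= ler_pdivlMr//; lra.
Qed.

(** The half-lines [(-oo, x)] generate the Borel sets and are stable by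
intersection, so they determine both the law of [f] and the image of the law of
[g]. *)
Lemma affine_equiv_cdf_eq f g (a b : R) : Dplus f -> Dplus g -> 0 < a ->
  (forall x, cdf_of f x = cdf_of g ((x - b) / a)) -> affine_equiv g f.
Proof.
move=> Df Dg a0 FG; exists a, b; split=> // A mA.
pose h := (fun x : measurableTypeR R => a * x + b : measurableTypeR R).
have mh : measurable_fun setT h by exact: measurable_affine.
pose P1 : {measure set (measurableTypeR R) -> \bar R} := Dplus_law Df.
pose P2 : {measure set (measurableTypeR R) -> \bar R} := pushforward (Dplus_law Dg) h.
suff : P1 A = P2 mh A by [].
refine (@measure_unique _ R (measurableTypeR R) (@RGenInftyO.G R)
  (fun n => `]-oo, n%:R[%classic) _ _ _ _ P1 (P2 mh) _ _ A mA).
- exact: RGenInftyO.measurableE.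
- move=> _ _ [x ->] [y ->]; exists (Num.min x y).
  by apply/seteqP; split => z /=; rewrite !in_itv/= lt_min => /andP.
- by move=> n; exists n%:R.
- rewrite -subTset => x _; exists (Num.truncn x).+1 => //=.
  by rewrite in_itv/= truncnS_gt.
- move=> _ [x ->]; rewrite /P2/= /pushforward /Dplus_law.
  have -> : h @^-1` `]-oo, x[%classic = `]-oo, (x - b) / a[%classic.
    by apply/seteqP; split => y /=; rewrite /h !in_itv/= ltr_pdivlMr//; lra.
  rewrite /law !integral_itv_bndo_bndc; last 2 first.
  + by apply: measurable_funTS; apply/measurable_EFinP; exact: Dplus_measurable.
  + by apply: measurable_funTS; apply/measurable_EFinP; exact: Dplus_measurable.
  by have := law_cdf Df x; have := law_cdf Dg ((x - b) / a); rewrite /law FG => -> ->.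
- by move=> n; apply: le_lt_trans (ltry 1); exact: (@probability_le1 _ _ _ (Dplus_law Df)).
Qed.

Lemma affine_equiv_cdf f g : Dplus g -> affine_equiv g f ->
  exists a b : R, 0 < a /\ forall x, cdf_of f x = cdf_of g ((x - b) / a).
Proof.
move=> Dg [a [b [a0 E]]]; exists a, b; split=> // x.
by rewrite /cdf_of E// affine_preimage.
Qed.

(** Off the support [cdf_of f] is 0 or 1, and there monotonicity of [cdf_of g]
forces the same value, since [cdf_of f] approaches 0 and 1 on the support. *)
Lemma affine_equiv_of_cdf f g (a b : R) : Dplus f -> Dplus g -> 0 < a ->
  (forall x, supp f x -> cdf_of f x = cdf_of g ((x - b) / a)) ->
  affine_equiv g f.
Proof.
move=> Df Dg a0 FG; apply: (affine_equiv_cdf_eq (b := b) Df Dg a0) => x.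
have [Ix|nIx] := pselect (supp f x); first exact: FG.
have monog y z : y <= z -> cdf_of g ((y - b) / a) <= cdf_of g ((z - b) / a).
  by move=> yz; apply: cdf_of_le => //; rewrite ler_pM2r ?invr_gt0// lerD2r.
set u := cdf_of g _.
have u0 : 0 <= u by exact: cdf_of_ge0.
have u1 : u <= 1 by exact: cdf_of_le1.
have [H|H] := off_supp_cases Df nIx.
  rewrite (cdf_of_below H); apply/eqP; rewrite eq_le u0/= leNgt.
  apply/negP => u_gt0.
  have : (`]0, 1[%classic : set R) (u / 2) by rewrite /= in_itv/=; lra.
  rewrite -(cdf_of_onto Df) => -[y Iy]; rewrite FG// => Ey.
  by have := monog _ _ (ltW (H y Iy)); rewrite -/u Ey; lra.
rewrite (cdf_of_above Df H); apply/eqP; rewrite eq_le u1 andbT leNgt.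
apply/negP => u_lt1.
have : (`]0, 1[%classic : set R) ((1 + u) / 2) by rewrite /= in_itv/=; lra.
rewrite -(cdf_of_onto Df) => -[y Iy]; rewrite FG// => Ey.
by have := monog _ _ (ltW (H y Iy)); rewrite -/u Ey; lra.
Qed.

End Affine.

(** * Smoothness of rational functions *)

Section Smooth.
Context {R : realType}.
Implicit Types (f g G : R -> R) (I : set R).

Lemma is_derive_rational (p q : {poly R}) (n : nat) (x : R) : q.[x] != 0 ->
  is_derive x 1 (fun y => p.[y] / q.[y] ^+ n)
    ((p^`() * q - n%:R *: (p * q^`())).[x] / q.[x] ^+ n.+1).
Proof.
move=> qx0.
case: n => [|n].
  have -> : (fun y => p.[y] / q.[y] ^+ 0) = horner p.
    by apply/funext => y; rewrite expr0 divr1.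
  by apply: is_derive_eq; rewrite !hornerE; field.
have qn0 : (horner q ^+ n.+1) x != 0 by rewrite fctE expf_neq0.
have d1 := is_deriveX n.+1 (is_derive_poly q x).
have d2 := is_deriveM (is_derive_poly p x) (is_deriveV qn0 d1).
have -> : (fun y => p.[y] / q.[y] ^+ n.+1) =
    horner p * (fun y => ((horner q ^+ n.+1) y)^-1) :> (R -> R).
  by apply/funext => y; rewrite !fctE.
apply: (@is_derive_eq _ _ _ _ _ _ _ _ d2).
rewrite /GRing.scale/= !fctE !(hornerD, hornerN, hornerZ, hornerM) !exprS; field.
by rewrite qx0 expf_neq0.
Qed.

Lemma derive1n_rational I g (K q : {poly R}) : open I ->
  (forall x, I x -> q.[x] != 0) -> (forall x, I x -> g x = K.[x] / q.[x]) ->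
  forall k, exists (p : {poly R}) (n : nat),
    forall x, I x -> derive1n k g x = p.[x] / q.[x] ^+ n.
Proof.
move=> oI q0 gE; elim=> [|k [p [n IH]]].
  by exists K, 1%N => x Ix; rewrite derive1n0 expr1 gE.
exists (p^`() * q - n%:R *: (p * q^`())), n.+1 => x Ix.
rewrite derive1nS derive1E; apply: derive_val.
apply: (is_derive_eq_on oI Ix (fun y Iy => esym (IH y Iy))).
by apply: is_derive_rational; exact: q0.
Qed.

(** All iterated derivatives are again of the form [p / q ^ n]. *)
Lemma C3_on_rational I g (K q : {poly R}) : open I ->
  (forall x, I x -> q.[x] != 0) -> (forall x, I x -> g x = K.[x] / q.[x]) ->
  C3_on I g.
Proof.
move=> oI q0 gE.
suff dg k x : I x -> derivable (derive1n k g) x 1.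
  split=> k x _ Ix; first exact: dg.
  by apply: is_derive_continuous; exact: derivableP (dg k x Ix).
move=> Ix; have [p [n E]] := derive1n_rational oI q0 gE k.
have := is_derive_eq_on oI Ix (fun y Iy => esym (E y Iy))
  (is_derive_rational p n (q0 x Ix)).
by case.
Qed.

End Smooth.

(** * Constant curvature and Moebius maps *)

Section Curvature.
Context {R : realType}.
Variable f : R -> R.
Hypotheses (Df : Dplus f) (C3f : C3_on (supp f) f).
Local Notation F := (cdf_of f).
Local Notation I := (supp f).
Local Notation f1 := (derive1n 1 f).
Local Notation f2 := (derive1n 2 f).

Let oI : open I. Proof. by case: Df. Qed.
Let itvI : is_interval I. Proof. by case: Df. Qed.
Let f_gt0 x : I x -> 0 < f x. Proof. by case: Df => _ _ + _ _; apply. Qed.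

Lemma is_derive_density x : I x -> is_derive x 1 f (f1 x).
Proof.
move=> Ix; have [+ _] := C3f => /(_ 0%N x isT Ix).
by rewrite derive1n1 derive1E; exact: derivableP.
Qed.

Lemma is_derive_density1 x : I x -> is_derive x 1 f1 (f2 x).
Proof.
move=> Ix; have [+ _] := C3f => /(_ 1%N x isT Ix).
by rewrite (derive1nS f 1) derive1E; exact: derivableP.
Qed.

Lemma derive1n_cdf k x : I x -> derive1n k.+1 F x = derive1n k f x.
Proof.
elim: k x => [|k IH] x Ix.
  rewrite derive1n1 derive1E; apply: derive_val; exact: is_derive_cdf.
rewrite (derive1nS F k.+1) (derive1nS f k) !derive1E; apply: near_eq_derive.
by near=> y; apply: IH; near: y; exact: open_nbhs_nbhs.
Unshelve. all: by end_near. Qed.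

(** As [F' = f] near each point of the support, the Schwarzian of [F] involves
only [f] and its first two derivatives. *)
Lemma RcurvE x : I x ->
  Rcurv f x = (f2 x / f x - 3 / 2 * (f1 x / f x) ^+ 2) / f x ^+ 2.
Proof. by move=> Ix; rewrite /Rcurv /schwarzian !derive1n_cdf// derive1n0. Qed.

End Curvature.

Section Uniformization.
Context {R : realType}.

(** The uniformizing function is [T = S / C]. The pair solves the oscillator
equation [y'' = - (k * m) y], and [W] is its Wronskian [S' C - S C']; only the
values of [T] on [(0, 1)], those of a distribution function on the support, are
used. *)
Definition uniformizing (k m W : R) (S C : R -> R) : Prop :=
  [/\ 0 < W,
      forall p : R, is_derive p 1 S (k * C p),
      forall p : R, is_derive p 1 C (- m * S p),
      forall p, k * C p ^+ 2 + m * S p ^+ 2 = W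
    & forall p, 0 < p < 1 -> C p != 0].

Variable f : R -> R.
Hypotheses (Df : Dplus f) (C3f : C3_on (supp f) f).
Local Notation F := (cdf_of f).
Local Notation I := (supp f).
Local Notation f1 := (derive1n 1 f).
Local Notation f2 := (derive1n 2 f).

Let oI : open I. Proof. by case: Df. Qed.
Let itvI : is_interval I. Proof. by case: Df. Qed.
Let f_gt0 x : I x -> 0 < f x. Proof. by case: Df => _ _ + _ _; apply. Qed.

(* In terms of w = f ^ (-1/2), the equation Rcurv f = - 2 q reads
   w'' = q f ^ 2 w. *)
Let w (x : R) : R := (Num.sqrt (f x))^-1.

Let is_derive_w x : I x -> is_derive x 1 w (- (1 / 2) * (f1 x / f x) * w x).
Proof.
move=> Ix; have fx := f_gt0 Ix.
have s0 : Num.sqrt (f x) != 0 by rewrite gt_eqF// sqrtr_gt0.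
have d1 := is_derive_compr (is_derive1_sqrt fx) (is_derive_density C3f Ix).
have d2 := is_derive_invr d1 s0; apply: (is_derive_to d2).
have E : f x = Num.sqrt (f x) ^+ 2 by rewrite sqr_sqrtr// ltW.
by rewrite /w; move: s0 E; set s := Num.sqrt _ => s0 ->; field.
Qed.

Let w2 x : I x -> f x * w x ^+ 2 = 1.
Proof.
move=> Ix; rewrite /w exprVn sqr_sqrtr ?ltW ?f_gt0// divff// gt_eqF// f_gt0.
Qed.

(** With [P'' = - q P] and [w'' = q f^2 w],
<<
((P o F) w)'' = - q (P o F) f^2 w + (P' o F) (f' w + 2 f w') + (P o F) w'' = 0
>>
since [f' w + 2 f w' = 0]. The second equation is the value of
[((P o F) w)']. *)
Lemma oscillator_affine (q : R) (P P1 : R -> R) :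
  (forall p : R, is_derive p 1 P (P1 p)) ->
  (forall p : R, is_derive p 1 P1 (- q * P p)) ->
  Rcurv_const f (- (2 * q)) ->
  exists a b : R, forall x, I x ->
    P (F x) * w x = a * x + b /\
    P1 (F x) * f x * w x - 1 / 2 * P (F x) * (f1 x / f x) * w x = a.
Proof.
move=> dP dP1 Rq.
pose v x := P (F x) * w x.
pose v1 x := P1 (F x) * f x * w x - 1 / 2 * P (F x) * (f1 x / f x) * w x.
apply: (derive2_0_affine (f := v) (df := v1) itvI).
  move=> x Ix.
  apply: (is_derive_to
    (is_derive_mulr (is_derive_compr (dP (F x)) (is_derive_cdf Df Ix))
      (is_derive_w Ix))).
  by rewrite /v1; ring.
move=> x Ix.
have fx0 : f x != 0 by rewrite gt_eqF// f_gt0.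
have dw := is_derive_w Ix.
have dPF := is_derive_compr (dP (F x)) (is_derive_cdf Df Ix).
have dP1F := is_derive_compr (dP1 (F x)) (is_derive_cdf Df Ix).
have df := is_derive_density C3f Ix.
have df1 := is_derive_density1 C3f Ix.
have d1 := is_derive_mulr (is_derive_mulr dP1F df) dw.
have d2 := is_derive_mulr (is_derive_mulr (is_derive_scaler (1 / 2) dPF)
  (is_derive_mulr df1 (is_derive_invr df fx0))) dw.
apply: (is_derive_to (is_deriveB d1 d2)).
have fx2 : f x ^+ 2 != 0 by rewrite expf_neq0.
have := Rq x Ix; rewrite (RcurvE Df)// => /(canRL (divfK fx2)) E.
have {}E : f2 x = f x * (3 / 2 * (f1 x / f x) ^+ 2 - 2 * q * f x ^+ 2).
  apply: (mulIf (invr_neq0 fx0)).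
  have -> : f2 x / f x = (f2 x / f x - 3 / 2 * (f1 x / f x) ^+ 2) +
    3 / 2 * (f1 x / f x) ^+ 2 by ring.
  by rewrite E; field.
by rewrite E; field.
Qed.


(** Both [(S o F) w] and [(C o F) w] are affine, hence their quotient is a
Moebius map. Its determinant is the Wronskian of these two functions, namely
[f w^2 (k (C o F)^2 + m (S o F)^2) = W]. *)
Lemma Rcurv_const_mobius (k m W : R) (S C : R -> R) :
  uniformizing k m W S C -> Rcurv_const f (- (2 * (k * m))) ->
  mobius_on I (fun x => S (F x) / C (F x)).
Proof.
move=> [W0 dS dC SC C0] Rq.
have dC1 (p : R) : is_derive p 1 (fun y => - m * S y) (- (k * m) * C p).
  by apply: (is_derive_to (is_derive_scaler (- m) (dS p))); ring.
have dS1 (p : R) : is_derive p 1 (fun y => k * C y) (- (k * m) * S p).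
  by apply: (is_derive_to (is_derive_scaler k (dC p))); ring.
have [a [b Sab]] := oscillator_affine dS dS1 Rq.
have [c [d Ccd]] := oscillator_affine dC dC1 Rq.
exists a, b, c, d; split.
  have [[x Ix]|I0] := pselect (exists x, I x); last first.
    have := cdf_of_onto Df; have : (`]0, 1[%classic : set R) (1 / 2).
      by rewrite /= in_itv/=; lra.
    by move=> + E; rewrite -E => -[x Ix _]; case: I0; exists x.
  have [Ea Ea'] := Sab x Ix; have [Ec Ec'] := Ccd x Ix.
  suff -> : a * d - b * c = W by rewrite gt_eqF.
  have -> : a * d - b * c = a * (c * x + d) - c * (a * x + b) by ring.
  rewrite -Ea -Ec -Ea' -Ec' -(SC (F x)).
  transitivity ((k * C (F x) ^+ 2 + m * S (F x) ^+ 2) * (f x * w x ^+ 2)).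
    ring.
  by rewrite w2// mulr1.
move=> x Ix; have [Ea _] := Sab x Ix; have [Ec _] := Ccd x Ix.
have w0 : w x != 0 by rewrite invr_eq0 gt_eqF// sqrtr_gt0 f_gt0.
have CF0 : C (F x) != 0 by apply: C0; exact: cdf_of_in01.
split; first by rewrite -Ec mulf_neq0.
rewrite /mobius -Ea -Ec; field; by rewrite w0 CF0.
Qed.

(** Both sides of [S (F x) / C (F x) = (a x + b) / (c x + d)] are
differentiated: [W f / C (F x)^2 = (a d - b c) / (c x + d)^2]. *)
Lemma mobius_density (k m W : R) (S C : R -> R) (a b c d : R) :
  uniformizing k m W S C ->
  (forall x, I x -> c * x + d != 0 /\
    S (F x) / C (F x) = mobius a b c d x) ->
  forall x, I x ->
    f x = (a * d - b * c) / W * (C (F x) / (c * x + d)) ^+ 2.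
Proof.
move=> [W0 dS dC SC C0] T x Ix.
have [z0 _] := T x Ix.
have CF0 : C (F x) != 0 by apply: C0; exact: cdf_of_in01.
have dSF := is_derive_compr (dS (F x)) (is_derive_cdf Df Ix).
have dCF := is_derive_compr (dC (F x)) (is_derive_cdf Df Ix).
have := is_derive_locally_unique oI Ix (fun y Iy => proj2 (T y Iy))
  (is_derive_mulr dSF (is_derive_invr dCF CF0))
  (is_derive_mulr (is_derive_affine a b x)
    (is_derive_invr (is_derive_affine c d x) z0)).
move=> E.
have W0' : W != 0 by rewrite gt_eqF.
have {E}E : W * f x / C (F x) ^+ 2 = (a * d - b * c) / (c * x + d) ^+ 2.
  rewrite -(SC (F x)).
  transitivity (k * C (F x) * f x / C (F x) +
    S (F x) * (- (- m * S (F x) * f x) / C (F x) ^+ 2)); first by field.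
  by rewrite E; field.
apply: (mulfI W0').
transitivity (W * f x / C (F x) ^+ 2 * C (F x) ^+ 2); first by field.
by rewrite E; field; rewrite z0 W0'.
Qed.

(** The formula of [mobius_density] gives the logarithmic derivative
[L = 2 (C' (F x) / C (F x) f - c / (c x + d))] of [f], and the curvature
satisfies [Rcurv f * f^2 = L' - L^2 / 2]. *)
Lemma mobius_Rcurv_const (k m W : R) (S C : R -> R) :
  uniformizing k m W S C ->
  mobius_on I (fun x => S (F x) / C (F x)) ->
  Rcurv_const f (- (2 * (k * m))).
Proof.
move=> U [a [b [c [d [D0 T]]]]].
have fE := mobius_density U T.
case: U => W0 dS dC SC C0 x Ix.
pose Y y := - m * S (F y) / C (F y).
pose L y := 2 * (Y y * f y - c / (c * y + d)).
have f1E y : I y -> f1 y = f y * L y.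
  move=> Iy; have [z0 _] := T y Iy.
  have CF0 : C (F y) != 0 by apply: C0; exact: cdf_of_in01.
  have dg := is_derive_mulr (is_derive_compr (dC (F y)) (is_derive_cdf Df Iy))
    (is_derive_invr (is_derive_affine c d y) z0).
  rewrite (is_derive_locally_unique oI Iy fE (is_derive_density C3f Iy)
    (is_derive_scaler _ (is_derive_mulr dg dg))).
  rewrite /L (fE y Iy) /Y; field; by rewrite z0 CF0 gt_eqF.
have [z0 _] := T x Ix.
have CF0 : C (F x) != 0 by apply: C0; exact: cdf_of_in01.
have fx0 : f x != 0 by rewrite gt_eqF// f_gt0.
have dSF := is_derive_compr (dS (F x)) (is_derive_cdf Df Ix).
have dCF := is_derive_compr (dC (F x)) (is_derive_cdf Df Ix).
have df := is_derive_density C3f Ix.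
have dY := is_derive_mulr (is_derive_scaler (- m) dSF) (is_derive_invr dCF CF0).
have dL := is_derive_scaler 2 (is_deriveB (is_derive_mulr dY df)
  (is_derive_scaler c (is_derive_invr (is_derive_affine c d x) z0))).
have f2E := is_derive_locally_unique oI Ix f1E (is_derive_density1 C3f Ix)
  (is_derive_mulr df dL).
rewrite (RcurvE Df)// f2E f1E// /L /Y !fctE.
field; by rewrite z0 CF0 fx0.
Qed.

End Uniformization.

(** * The three uniformizing functions *)

Section Pairs.
Context {R : realType}.

Lemma is_derive_phase (x : R) :
  is_derive x 1 (fun p => pi * (p - 1 / 2)) pi.
Proof.
have -> : (fun p : R => pi * (p - 1 / 2)) = (fun p => pi * p + - (pi / 2)).
  by apply/funext => p; ring.
exact: is_derive_affine.
Qed.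

Lemma phase_itv (p : R) : 0 < p < 1 -> - (pi / 2) < pi * (p - 1 / 2) < pi / 2.
Proof.
move=> p01; have pi0 := pi_gt0 R.
have h1 : 0 < pi * p by rewrite mulr_gt0; lra.
have h2 : 0 < pi * (1 - p) by rewrite mulr_gt0; lra.
lra.
Qed.

Lemma uniformizing_tan : uniformizing pi pi pi
  (fun p : R => sin (pi * (p - 1 / 2))) (fun p => cos (pi * (p - 1 / 2))).
Proof.
split; first exact: pi_gt0.
- move=> p; apply: (is_derive_to (is_derive_compr (is_derive_sin _) (is_derive_phase p))).
  exact: mulrC.
- move=> p; apply: (is_derive_to (is_derive_compr (is_derive_cos _) (is_derive_phase p))).
  ring.
- by move=> p; rewrite -mulrDr cos2Dsin2 mulr1.
- by move=> p p01; rewrite gt_eqF// cos_gt0_pihalf// phase_itv.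
Qed.

Lemma uniformizing_id : uniformizing 1 0 1 (@id R) (fun=> 1).
Proof.
split=> //.
- by move=> p; rewrite mulr1; exact: is_derive_id.
- by move=> p; rewrite oppr0 mul0r; exact: is_derive_cst.
- by move=> p; ring.
Qed.

(** The Wronskian is [4 * pi] because [S] and [C] are twice the hyperbolic sine
and cosine. *)
Lemma uniformizing_tanh : uniformizing pi (- pi) (4 * pi)
  (fun p : R => expR (pi * (p - 1 / 2)) - expR (- (pi * (p - 1 / 2))))
  (fun p => expR (pi * (p - 1 / 2)) + expR (- (pi * (p - 1 / 2)))).
Proof.
have dp p := is_derive_compr (is_derive_expR _) (is_derive_phase p).
have dn p := is_derive_compr (is_derive_expR _) (is_deriveN (is_derive_phase p)).
split.
- by rewrite mulr_gt0 ?pi_gt0.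
- move=> p; apply: (is_derive_to (is_deriveB (dp p) (dn p))); rewrite !fctE; ring.
- move=> p; apply: (is_derive_to (is_deriveD (dp p) (dn p))); rewrite !fctE; ring.
- move=> p; have := expRxMexpNx_1 (pi * (p - 1 / 2)).
  set u := expR _; set v := expR _ => uv.
  have -> : pi * (u + v) ^+ 2 + - pi * (u - v) ^+ 2 = 4 * pi * (u * v) by ring.
  by rewrite uv mulr1.
- by move=> p _; rewrite gt_eqF// addr_gt0 ?expR_gt0.
Qed.

Lemma tanhE (t : R) : tanh t = (expR t ^+ 2 - 1) / (expR t ^+ 2 + 1).
Proof.
rewrite /tanh expRN; have e0 := expR_gt0 t; set u := expR t in e0 *.
have u0 : u != 0 by rewrite gt_eqF.
have u1 : u ^+ 2 + 1 != 0 by rewrite gt_eqF// addr_gt0 ?exprn_gt0.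
by field; rewrite u1 u0.
Qed.

Definition artanh (y : R) : R := ln ((1 + y) / (1 - y)) / 2.

Lemma artanh_arg_gt0 (y : R) : -1 < y < 1 -> 0 < (1 + y) / (1 - y).
Proof. by move=> y1; rewrite divr_gt0; lra. Qed.

Lemma artanhK (y : R) : -1 < y < 1 -> tanh (artanh y) = y.
Proof.
move=> y1; rewrite tanhE /artanh -expRM_natr mulfVK ?lnK ?posrE ?artanh_arg_gt0//.
by field; lra.
Qed.

Lemma tanhK : cancel (@tanh R) artanh.
Proof.
move=> t; rewrite tanhE /artanh; have e0 := expR_gt0 t.
have u1 : expR t ^+ 2 + 1 != 0 by rewrite gt_eqF// addr_gt0 ?exprn_gt0.
have -> : (1 + (expR t ^+ 2 - 1) / (expR t ^+ 2 + 1)) /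
  (1 - (expR t ^+ 2 - 1) / (expR t ^+ 2 + 1)) = expR t ^+ 2.
  by field; rewrite u1; lra.
by rewrite lnXn// expRK -mulr_natr; field.
Qed.

Lemma tanh_itv (t : R) : -1 < tanh t < 1.
Proof.
rewrite tanhE; have := exprn_gt0 2 (expR_gt0 t); set u := _ ^+ 2 => u0.
by rewrite ltr_pdivlMr ?ltr_pdivrMr; lra.
Qed.

Lemma is_derive_tanh (t : R) : is_derive t 1 (@tanh R) (1 - tanh t ^+ 2).
Proof.
have dn := is_derive_compr (is_derive_expR _) (is_deriveN (is_derive_id t 1)).
have d0 : expR t + expR (- t) != 0 by rewrite gt_eqF// addr_gt0 ?expR_gt0.
have := is_derive_mulr (is_deriveB (is_derive_expR t) dn)
  (is_derive_invr (is_deriveD (is_derive_expR t) dn) d0).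
move=> d; apply: (is_derive_to d); rewrite /tanh !fctE.
by field.
Qed.

Lemma tanh_lt : {mono (@tanh R) : x y / x < y}.
Proof.
apply: leW_mono; apply: le_mono => x y xy.
apply: (@derive_gt0_increasing R setT _ _ _ (fun x _ => is_derive_tanh x)) => //.
move=> t _; have := tanh_itv t; nra.
Qed.

Lemma tanhN (t : R) : tanh (- t) = - tanh t.
Proof. by rewrite /tanh opprK -mulNr opprB; congr (_ / _); exact: addrC. Qed.

Lemma is_derive_artanh (y : R) : -1 < y < 1 ->
  is_derive y 1 artanh (1 - y ^+ 2)^-1.
Proof.
move=> y1.
have n0 : 1 - y != 0 by lra.
have dnum : is_derive y 1 (fun z : R => 1 * z + 1) 1 := is_derive_affine 1 1 y.
have dden : is_derive y 1 (fun z : R => -1 * z + 1) (-1) := is_derive_affine (-1) 1 y.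
have n0' : -1 * y + 1 != 0 by lra.
have d1 := is_derive_mulr dnum (is_derive_invr dden n0').
have E (z : R) : (1 * z + 1) / (-1 * z + 1) = (1 + z) / (1 - z).
  by congr (_ / _); ring.
have a0 : 0 < (1 * y + 1) / (-1 * y + 1) by rewrite E artanh_arg_gt0.
have d := is_derive_scaler (1 / 2) (is_derive_compr
  (g := fun z => (1 * z + 1) / (-1 * z + 1)) (is_derive1_ln a0) d1).
have -> : artanh = (fun z => 1 / 2 * ln ((1 * z + 1) / (-1 * z + 1))).
  by apply/funext => z; rewrite /artanh E; lra.
apply: (is_derive_to d); field.
rewrite n0'; apply/and3P; split; nra.
Qed.

End Pairs.

(** * Explicit laws with constant curvature *)

Section Families.
Context {R : realType}.
Implicit Types (f g G : R -> R) (I : set R).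

Lemma phase_lt01 (t : R) : - (pi / 2) < t < pi / 2 -> 0 < 1 / 2 + t / pi < 1.
Proof.
move=> /andP[t1 t2]; have p0 := pi_gt0 R; move: (pi : R) p0 t1 t2 => P P0 t1 t2.
have h1 : t / P < 1 / 2 by rewrite ltr_pdivrMr//; lra.
have h2 : - (1 / 2) < t / P by rewrite ltr_pdivlMr//; lra.
lra.
Qed.

Lemma phaseK (u : R) : 1 / 2 + pi * (u - 1 / 2) / pi = u.
Proof.
by have := lt0r_neq0 (pi_gt0 R); move: (pi : R) => P P0; field.
Qed.

Lemma phaseVK (t : R) : pi * (1 / 2 + t / pi - 1 / 2) = t.
Proof.
by have := lt0r_neq0 (pi_gt0 R); move: (pi : R) => P P0; field.
Qed.

(** The common pattern of all explicit densities below: [g] is a constant over a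
polynomial on its support. *)
Lemma rational_law I g G (K : R) (q : {poly R}) : open I -> is_interval I ->
  0 < K -> (forall x, I x -> 0 < q.[x]) ->
  (forall x, I x -> g x = K / q.[x]) -> (forall x, ~ I x -> g x = 0) ->
  (forall x, I x -> is_derive x 1 G (g x)) -> G @` I = `]0, 1[%classic ->
  [/\ Dplus g, supp g = I, C3_on I g & forall x, I x -> cdf_of g x = G x].
Proof.
move=> oI itvI K0 q0 gE g0 dG Gonto.
have g_gt0 x : I x -> 0 < g x by move=> Ix; rewrite gE// divr_gt0// q0.
have gI : supp g = I by exact: supp_of_positive_on.
have C3g : C3_on I g.
  apply: (C3_on_rational (K := K%:P) (q := q) oI) => x Ix.
    by rewrite gt_eqF// q0.
  by rewrite hornerC gE.
have Dg : Dplus g.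
  apply: (Dplus_of_primitive oI itvI g_gt0 g0 _ dG Gonto) => x Ix.
  by have [_ /(_ 0%N x isT Ix)] := C3g.
split=> // x Ix; apply: (cdf_of_primitive_unique Dg); by rewrite gI.
Qed.

Lemma is_derive_mobius (a b c d x : R) : c * x + d != 0 ->
  is_derive x 1 (mobius a b c d) ((a * d - b * c) / (c * x + d) ^+ 2).
Proof.
move=> z0; have d1 := is_derive_mulr (is_derive_affine a b x)
  (is_derive_invr (is_derive_affine c d x) z0).
by apply: (is_derive_to d1); field.
Qed.

Lemma horner_affine (c d x : R) : (c *: 'X + d%:P).[x] = c * x + d.
Proof. by rewrite !hornerE. Qed.

Lemma parabolic_law I g (a b c d : R) : open I -> is_interval I ->
  0 < a * d - b * c -> (forall x, I x -> c * x + d != 0) ->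
  (forall x, I x -> g x = (a * d - b * c) / (c * x + d) ^+ 2) ->
  (forall x, ~ I x -> g x = 0) ->
  mobius a b c d @` I = `]0, 1[%classic ->
  [/\ Dplus g, supp g = I, C3_on I g
    & forall x, I x -> cdf_of g x = mobius a b c d x].
Proof.
move=> oI itvI D0 z0 gE g0 onto.
apply: (rational_law (q := (c *: 'X + d%:P) ^+ 2) oI itvI D0 _ _ g0 _ onto).
- by move=> x Ix; rewrite horner_exp horner_affine exprn_even_gt0//= z0.
- by move=> x Ix; rewrite horner_exp horner_affine gE.
- by move=> x Ix; rewrite gE//; apply: is_derive_mobius; exact: z0.
Qed.

(** The density is the derivative of [1 / 2 + artanh h / pi] for the given
Moebius map [h]; positivity of the denominator is [h^2 < 1]. *)
Lemma hyperbolic_law I g (a b c d : R) : open I -> is_interval I ->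
  0 < a * d - b * c -> (forall x, I x -> c * x + d != 0) ->
  (forall x, I x ->
     g x = (a * d - b * c) / (pi * ((c * x + d) ^+ 2 - (a * x + b) ^+ 2))) ->
  (forall x, ~ I x -> g x = 0) ->
  mobius a b c d @` I = `]- tanh (pi / 2), tanh (pi / 2)[%classic ->
  [/\ Dplus g, supp g = I, C3_on I g, Rcurv_const g (2 * pi ^+ 2)
    & forall x, I x -> cdf_of g x = 1 / 2 + artanh (mobius a b c d x) / pi].
Proof.
move=> oI itvI D0 z0 gE g0 onto; have pi0 := pi_gt0 R.
have h_itv x : I x -> -1 < mobius a b c d x < 1.
  move=> Ix; have : (mobius a b c d @` I) (mobius a b c d x) by exists x.
  by rewrite onto /= in_itv/=; have := tanh_itv (pi / 2 : R); lra.
have q_gt0 x : I x -> 0 < (c * x + d) ^+ 2 - (a * x + b) ^+ 2.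
  move=> Ix; have := h_itv x Ix; rewrite /mobius; set y := _ / _ => y1.
  have -> : a * x + b = y * (c * x + d) by rewrite /y divfK// z0.
  have z2 : 0 < (c * x + d) ^+ 2 by rewrite exprn_even_gt0//= z0.
  have -> : (c * x + d) ^+ 2 - (y * (c * x + d)) ^+ 2 =
    (1 - y) * (1 + y) * (c * x + d) ^+ 2 by ring.
  by apply: mulr_gt0 => //; apply: mulr_gt0; lra.
pose q : {poly R} := pi *: ((c *: 'X + d%:P) ^+ 2 - (a *: 'X + b%:P) ^+ 2).
have qE x : q.[x] = pi * ((c * x + d) ^+ 2 - (a * x + b) ^+ 2).
  by rewrite hornerZ hornerD hornerN !horner_exp !horner_affine.
pose G x := 1 / 2 + artanh (mobius a b c d x) / pi.
have [] := @rational_law I g G (a * d - b * c) q oI itvI D0 _ _ g0.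
- by move=> x Ix; rewrite qE mulr_gt0// q_gt0.
- by move=> x Ix; rewrite qE gE.
- move=> x Ix.
  have d1 := is_derive_scaler pi^-1 (is_derive_compr
    (is_derive_artanh (h_itv x Ix)) (is_derive_mobius a b (z0 x Ix))).
  have -> : G = (fun y => pi^-1 * artanh (mobius a b c d y)) + cst (1 / 2).
    by apply/funext => y; rewrite !fctE /G; ring.
  apply: (is_derive_to (is_deriveD d1 (is_derive_cst _ _ _))).
  rewrite gE// /mobius addr0; have := q_gt0 x Ix; have := z0 x Ix.
  move: (lt0r_neq0 pi0) => + zx /lt0r_neq0 qx; move: (pi : R) => P P0.
  by field; rewrite zx qx P0.
- apply/seteqP; split => [_ [x Ix <-]|u] /=; rewrite in_itv/=.
    have : (mobius a b c d @` I) (mobius a b c d x) by exists x.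
    rewrite onto /= in_itv/= -tanhN -{1 2}(artanhK (h_itv x Ix)) !tanh_lt /G.
    exact: phase_lt01.
  move=> u01; have /andP[ph1 ph2] := phase_itv u01.
  have : (`]- tanh (pi / 2), tanh (pi / 2)[%classic : set R)
      (tanh (pi * (u - 1 / 2))).
    by rewrite /= in_itv/= -tanhN !tanh_lt ph1 ph2.
  rewrite -onto => -[x Ix hx]; exists x => //.
  by rewrite /G hx tanhK phaseK.
move=> Dg gI C3g FG; split=> //.
rewrite -gI in C3g; have -> : 2 * pi ^+ 2 = - (2 * (pi * - pi)) :> R by ring.
apply: (mobius_Rcurv_const Dg C3g uniformizing_tanh).
exists a, b, c, d; split; first by rewrite gt_eqF.
rewrite gI => x Ix; split; first exact: z0.
by rewrite (FG x Ix) -/(tanh _) /G phaseVK artanhK// h_itv.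
Qed.

Lemma cauchy_law (m gamma : R) : 0 < gamma ->
  [/\ Dplus (cauchy_density m gamma), supp (cauchy_density m gamma) = setT,
      C3_on setT (cauchy_density m gamma)
    & forall x, cdf_of (cauchy_density m gamma) x =
                1 / 2 + atan ((x - m) / gamma) / pi].
Proof.
move=> g0; have pi0 := pi_gt0 R.
pose q : {poly R} := pi *: ((1 *: 'X + (- m)%:P) ^+ 2 + (gamma ^+ 2)%:P).
have qE x : q.[x] = pi * ((x - m) ^+ 2 + gamma ^+ 2).
  by rewrite hornerZ hornerD !horner_exp horner_affine hornerC mul1r.
have q_gt0 x : 0 < (x - m) ^+ 2 + gamma ^+ 2.
  by rewrite ltr_wpDl ?sqr_ge0 ?exprn_gt0.
pose G x := 1 / 2 + atan ((x - m) / gamma) / pi.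
have [] := @rational_law setT (cauchy_density m gamma) G gamma q openT _ g0.
- by [].
- by move=> x _; rewrite qE mulr_gt0// q_gt0.
- by move=> x _; rewrite qE.
- by move=> x /(_ I).
- move=> x _.
  have d1 := is_derive_scaler pi^-1 (is_derive_compr (is_derive1_atan _)
     (is_derive_affine gamma^-1 (- m / gamma) x)).
  have -> : G = (fun y => pi^-1 * atan (gamma^-1 * y + - m / gamma)) + cst (1 / 2).
    apply/funext => y; rewrite !fctE /G.
    have -> : gamma^-1 * y + - m / gamma = (y - m) / gamma by ring.
    ring.
  apply: (is_derive_to (is_deriveD d1 (is_derive_cst _ _ _))).
  have := q_gt0 x; rewrite /cauchy_density addr0 => qx.
  have -> : 1 + (gamma^-1 * x + - m / gamma) ^+ 2 =
    ((x - m) ^+ 2 + gamma ^+ 2) / gamma ^+ 2 by field; rewrite gt_eqF.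
  move: (lt0r_neq0 pi0) (lt0r_neq0 g0) (lt0r_neq0 qx) => + g0' qx0.
  by move: (pi : R) => P P0; field; rewrite P0 g0' qx0.
- apply/seteqP; split => [_ [x _ <-]|u] /=; rewrite in_itv/=.
    by apply: phase_lt01; rewrite atan_gtNpi2 atan_ltpi2.
  move=> u01; have ph := phase_itv u01.
  exists (m + gamma * tan (pi * (u - 1 / 2))) => //.
  rewrite /G (_ : (_ - m) / gamma = tan (pi * (u - 1 / 2))); last first.
    by field; rewrite gt_eqF.
  by rewrite tanK ?in_itv// phaseK.
by move=> Dg gI C3g FG; split=> // x; exact: FG.
Qed.

End Families.

(** * The three families and the classification of zero curvature *)

Section Classification.
Context {R : realType}.
Implicit Types (f g G h : R -> R) (I : set R).

Lemma mobius_on_ext I h h' : (forall x, I x -> h x = h' x) ->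
  mobius_on I h -> mobius_on I h'.
Proof.
move=> E [a [b [c [d [D0 H]]]]]; exists a, b, c, d; split=> // x Ix.
by rewrite -E//; exact: H.
Qed.

(** The map is injective on the projective line and [a / c] is its value at
infinity. *)
Lemma mobius_omits (a b c d x : R) : a * d - b * c != 0 -> c != 0 ->
  c * x + d != 0 -> mobius a b c d x != a / c.
Proof.
move=> D0 c0 z0; apply: contra_neq D0; rewrite /mobius => E.
have := congr1 (fun y => y * (c * x + d) * c) E.
have -> : (a * x + b) / (c * x + d) * (c * x + d) * c = (a * x + b) * c.
  by rewrite divfK.
have -> : a / c * (c * x + d) * c = a * (c * x + d) by field.
lra.
Qed.

Section OneLaw.
Variable f : R -> R.
Hypotheses (Df : Dplus f) (C3f : C3_on (supp f) f).
Local Notation F := (cdf_of f).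
Local Notation I := (supp f).

Let f_gt0 x : I x -> 0 < f x. Proof. by case: Df => _ _ + _ _; apply. Qed.

Lemma cdf_of_reach (u : R) : 0 < u < 1 -> exists2 x, I x & F x = u.
Proof.
move=> u01; have : (`]0, 1[%classic : set R) u by rewrite /= in_itv.
by rewrite -(cdf_of_onto Df) => -[x Ix Fx]; exists x.
Qed.

Lemma supp_nonempty : exists x, I x.
Proof.
have u01 : 0 < (1 / 2 : R) < 1 by lra.
by have [x Ix _] := cdf_of_reach u01; exists x.
Qed.

(** By [mobius_density] the determinant has the sign of [f]. *)
Lemma mobius_det_gt0 (k m W : R) (S C : R -> R) (a b c d : R) :
  uniformizing k m W S C ->
  (forall x, I x -> c * x + d != 0 /\
    S (F x) / C (F x) = mobius a b c d x) -> 0 < a * d - b * c.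
Proof.
move=> U T; have [x Ix] := supp_nonempty.
have := f_gt0 Ix; rewrite (mobius_density Df U T)//.
case: U => W0 _ _ _ C0; have [z0 _] := T x Ix.
have CF0 : C (F x) != 0 by apply: C0; exact: cdf_of_in01.
have : 0 < (C (F x) / (c * x + d)) ^+ 2.
  by rewrite exprn_even_gt0//= mulf_neq0// invr_eq0.
by move=> /pmulr_lgt0 ->; rewrite pmulr_lgt0// invr_gt0.
Qed.

Lemma elliptic_curvature : Rcurv_const f (- (2 * pi ^+ 2)) <->
  mobius_on I (fun x => tan (pi * (F x - 1 / 2))).
Proof.
have -> : 2 * pi ^+ 2 = 2 * (pi * pi) :> R by ring.
by split; [exact: Rcurv_const_mobius uniformizing_tan
          |exact: mobius_Rcurv_const uniformizing_tan].
Qed.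

(** The Moebius map has image [R], so it omits no value and is affine; being
onto [R], it is then defined on the whole line. *)
Lemma elliptic_cauchy : mobius_on I (fun x => tan (pi * (F x - 1 / 2))) ->
  exists m gamma : R, 0 < gamma /\ forall x, f x = cauchy_density m gamma x.
Proof.
move=> [a [b [c [d [D0 T]]]]].
have D_gt0 := mobius_det_gt0 uniformizing_tan T.
have onto (y : R) : exists2 x, I x & mobius a b c d x = y.
  have u01 : 0 < 1 / 2 + atan y / pi < 1.
    by apply: phase_lt01; rewrite atan_gtNpi2 atan_ltpi2.
  have [x Ix Fx] := cdf_of_reach u01; exists x => //.
  by have [_ <-] := T x Ix; rewrite Fx phaseVK atanK.
have c0 : c = 0.
  apply/eqP; apply: contraT => c0; have [x Ix E] := onto (a / c).
  by have [z0 _] := T x Ix; have := mobius_omits D0 c0 z0; rewrite E eqxx.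
rewrite c0 mulr0 subr0 in D_gt0 D0.
move: (D0); rewrite mulf_eq0 negb_or => /andP[a0 d0].
have IT x : I x.
  have [y Iy] := onto (mobius a b c d x); rewrite /mobius c0 !mul0r !add0r.
  move/(mulIf (invr_neq0 d0))/addIr/(mulfI a0) => <-//.
exists (- b / a), (d / a); split.
  have -> : d / a = a * d / a ^+ 2 by field.
  by rewrite divr_gt0// exprn_even_gt0.
move=> x; have [z0 Tx] := T x (IT x).
rewrite (mobius_density Df uniformizing_tan T)// /cauchy_density.
have cx0 : cos (pi * (F x - 1 / 2)) != 0.
  by case: (@uniformizing_tan R) => _ _ _ _; apply; exact: cdf_of_in01.
have := cos2_tan2 cx0; rewrite Tx /mobius c0 !mul0r !add0r.
move: (lt0r_neq0 (pi_gt0 R)) cx0; set w := cos _; move: (pi : R) w.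
move=> P w P0 w0 E.
have {}E : w ^+ 2 = (1 + ((a * x + b) / d) ^+ 2)^-1 by rewrite -E invrK.
rewrite mulr0 subr0 expr_div_n E.
have q0 : d ^+ 2 + (a * x + b) ^+ 2 != 0.
  by rewrite gt_eqF// ltr_wpDr ?sqr_ge0// exprn_even_gt0.
have -> : 1 + ((a * x + b) / d) ^+ 2 = (d ^+ 2 + (a * x + b) ^+ 2) / d ^+ 2.
  by field.
have -> : (x - - b / a) ^+ 2 + (d / a) ^+ 2 =
  (d ^+ 2 + (a * x + b) ^+ 2) / a ^+ 2 by field.
move: (d ^+ 2 + (a * x + b) ^+ 2) q0 => q q0; by field; rewrite P0 a0 d0 q0.
Qed.

Lemma cauchy_mobius (m gamma : R) : 0 < gamma ->
  (forall x, f x = cauchy_density m gamma x) ->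
  mobius_on I (fun x => tan (pi * (F x - 1 / 2))).
Proof.
move=> g0 /funext fE; have [_ _ _ FE] := cauchy_law m g0.
exists 1, (- m), 0, gamma; split.
  by rewrite mul1r mulr0 subr0 gt_eqF.
move=> x _; rewrite mul0r add0r gt_eqF//; split=> //.
by rewrite fE FE phaseVK atanK /mobius mul0r add0r mul1r.
Qed.

Lemma parabolic_curvature : Rcurv_const f 0 <-> mobius_on I F.
Proof.
have -> : 0 = - (2 * (1 * 0)) :> R by ring.
split=> [/(Rcurv_const_mobius Df C3f uniformizing_id)|H].
  by apply: mobius_on_ext => x _; rewrite divr1.
apply: (mobius_Rcurv_const Df C3f uniformizing_id).
by apply: mobius_on_ext H => x _; rewrite divr1.
Qed.

Lemma hyperbolic_curvature : Rcurv_const f (2 * pi ^+ 2) <->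
  mobius_on I (fun x => tanh (pi * (F x - 1 / 2))).
Proof.
have -> : 2 * pi ^+ 2 = - (2 * (pi * - pi)) :> R by ring.
by split; [exact: Rcurv_const_mobius uniformizing_tanh
          |exact: mobius_Rcurv_const uniformizing_tanh].
Qed.

Lemma tanh_phase_onto : (fun x => tanh (pi * (F x - 1 / 2))) @` I =
  `]- tanh (pi / 2), tanh (pi / 2)[%classic.
Proof.
apply/seteqP; split => [_ [x Ix <-]|y] /=; rewrite in_itv/=.
  by rewrite -tanhN !tanh_lt phase_itv// cdf_of_in01.
move=> y01; have y1 : -1 < y < 1 by have := tanh_itv (pi / 2 : R); lra.
have u01 : 0 < 1 / 2 + artanh y / pi < 1.
  apply: phase_lt01; apply/andP; split; rewrite -tanh_lt artanhK// ?tanhN; lra.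
have [x Ix Fx] := cdf_of_reach u01; exists x => //.
by rewrite Fx phaseVK artanhK.
Qed.

End OneLaw.

Lemma truncated_law (c : R) : -1 < c ->
  [/\ Dplus (truncated_density c), supp (truncated_density c) = `]0, 1[%classic,
      C3_on `]0, 1[%classic (truncated_density c)
    & forall x, 0 < x < 1 ->
        cdf_of (truncated_density c) x = mobius (1 + c) 0 c 1 x].
Proof.
move=> c1; have z_gt0 (x : R) : 0 < x < 1 -> 0 < c * x + 1.
  by move=> x01; have : 0 < (1 + c) * x by [rewrite mulr_gt0; lra]; lra.
have [|||||||D s C FE] := @parabolic_law R `]0, 1[%classic (truncated_density c)
  (1 + c) 0 c 1.
- exact: interval_open.
- exact: interval_is_interval.
- lra.
- by move=> x; rewrite /= in_itv/= => x01; rewrite gt_eqF// z_gt0//; lra.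
- move=> x x01; rewrite /truncated_density indicE mem_set// mulr1.
  by rewrite mulr1 mul0r subr0 (addrC 1 (c * x)).
- by move=> x x01; rewrite /truncated_density indicE memNset// mulr0.
- apply/seteqP; split => [_ [x + <-]|u]; rewrite /= !in_itv/= => x01.
    have z0 : 0 < c * x + 1 by apply: z_gt0; lra.
    have p0 : 0 < (1 + c) * x by rewrite mulr_gt0; lra.
    by rewrite /mobius addr0 ltr_pdivrMr// divr_gt0//; lra.
  have z0 : 0 < 1 + c - c * u.
    have : 0 < (1 + c) * (1 - u) by [rewrite mulr_gt0; lra]; lra.
  exists (u / (1 + c - c * u)).
    have p0 : 0 < (1 + c) * (1 - u) by rewrite mulr_gt0; lra.
    by rewrite /= in_itv/= divr_gt0 ?ltr_pdivrMr//; lra.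
  rewrite /mobius; field; rewrite gt_eqF//=.
  by rewrite (_ : c * u + (1 + c - c * u) = 1 + c) ?gt_eqF//; [lra|ring].
by split=> // x x01; apply: FE; rewrite /= in_itv.
Qed.

Lemma uniform_truncated : uniform_density = truncated_density (0 : R).
Proof.
apply/funext => x; rewrite /uniform_density /truncated_density.
by rewrite addr0 mul0r addr0 expr1n divr1 mul1r.
Qed.

Lemma lomax_law : [/\ Dplus (@lomax_density R),
    supp (@lomax_density R) = `]0, +oo[%classic,
    C3_on `]0, +oo[%classic (@lomax_density R)
  & forall x, 0 < x -> cdf_of (@lomax_density R) x = mobius 1 0 1 1 x].
Proof.
have [|||||||D s C FE] := @parabolic_law R `]0, +oo[%classic (@lomax_density R)
  1 0 1 1.
- exact: interval_open.
- exact: interval_is_interval.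
- lra.
- by move=> x; rewrite /= in_itv/= andbT => x0; rewrite gt_eqF//; lra.
- move=> x x01; rewrite /lomax_density indicE mem_set// mulr1.
  by move: x01; rewrite /= in_itv/= andbT => x0; field; rewrite !gt_eqF//; lra.
- by move=> x x01; rewrite /lomax_density indicE memNset// mulr0.
- apply/seteqP; split => [_ [x + <-]|u]; rewrite /= !in_itv/= ?andbT => x01.
    by rewrite /mobius addr0 mul1r ltr_pdivrMr ?divr_gt0//; lra.
  exists (u / (1 - u)); first by rewrite /= in_itv/= andbT divr_gt0//; lra.
  by rewrite /mobius; field; lra.
by split=> // x x01; apply: FE; rewrite /= in_itv/= andbT.
Qed.

Lemma reflected_lomax_law : [/\ Dplus (reflect (@lomax_density R)),
    supp (reflect (@lomax_density R)) = `]-oo, 0[%classic,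
    C3_on `]-oo, 0[%classic (reflect (@lomax_density R))
  & forall x, x < 0 -> cdf_of (reflect (@lomax_density R)) x = mobius 0 1 (-1) 1 x].
Proof.
have [|||||||D s C FE] := @parabolic_law R `]-oo, 0[%classic
  (reflect (@lomax_density R)) 0 1 (-1) 1.
- exact: interval_open.
- exact: interval_is_interval.
- lra.
- by move=> x; rewrite /= in_itv/= => x0; rewrite gt_eqF//; lra.
- move=> x; rewrite /= in_itv/= => x0.
  rewrite /reflect /lomax_density indicE mem_set ?mulr1; last first.
    by rewrite /= in_itv/= andbT; lra.
  have -> : 0 - 1 * -1 = 1 :> R by ring.
  by rewrite div1r mulN1r addrC.
- move=> x; rewrite /= in_itv/= => x0; rewrite /reflect /lomax_density.
  rewrite indicE memNset ?mulr0//= in_itv/= andbT; move: x0 => /negP; lra.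
- apply/seteqP; split => [_ [x + <-]|u]; rewrite /= !in_itv/= => x01.
    by rewrite /mobius mul0r add0r div1r invr_gt0 invf_lt1; lra.
  exists (1 - u^-1); first by rewrite /= in_itv/= subr_lt0 invf_gt1; lra.
  by rewrite /mobius; field; lra.
by split=> // x x01; apply: FE; rewrite /= in_itv.
Qed.

(** A point of the support of [f] has [0 < cdf_of f < 1], so its image by the
affine change of variable is a point of the support of [g]. *)
Lemma affine_equiv_mobius f g : Dplus f -> Dplus g ->
  mobius_on (supp g) (cdf_of g) -> affine_equiv g f -> mobius_on (supp f) (cdf_of f).
Proof.
move=> Df Dg [a [b [c [d [D0 T]]]]] /(affine_equiv_cdf Dg)[s [t [s0 E]]].
exists a, (b * s - a * t), c, (d * s - c * t); split.
  have -> : a * (d * s - c * t) - (b * s - a * t) * c = s * (a * d - b * c).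
    ring.
  by rewrite mulf_neq0// gt_eqF.
move=> x Ix; have Iy : supp g ((x - t) / s).
  apply: contrapT => /(off_supp_cases Dg) H.
  have := cdf_of_in01 Df Ix; rewrite E.
  by case: H => [/(cdf_of_below)|/(cdf_of_above Dg)] ->; lra.
have [z0 Ty] := T _ Iy; have s0' : s != 0 by rewrite gt_eqF.
have zE : c * x + (d * s - c * t) = (c * ((x - t) / s) + d) * s by field.
split; first by rewrite zE mulf_neq0.
rewrite E Ty /mobius zE.
have -> : a * x + (b * s - a * t) = (a * ((x - t) / s) + b) * s by field.
by rewrite -mulf_div divff ?mulr1.
Qed.

(** Let [F = (a x + b) / (c x + d)]. If [c] is not zero, the omitted value
[a / c] is not in [(0, 1)]; if moreover it is 0 or 1, the support is a half-line
and the law is the reflected Lomax law or the Lomax law. Otherwise, [F] takes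
the values 0 and 1 at [- b / a] and [(d - b) / (a - c)], and the affine map
sending these two points to 0 and 1 turns [F] into the distribution function of
the truncated law of parameter [c / (a - c)]. *)
Lemma parabolic_classification f : Dplus f -> C3_on (supp f) f ->
  Rcurv_const f 0 <->
    affine_equiv (@uniform_density R) f \/ affine_equiv (@lomax_density R) f \/
    affine_equiv (reflect (@lomax_density R)) f \/
    exists c : R, -1 < c /\ affine_equiv (truncated_density c) f.
Proof.
move=> Df C3f; rewrite parabolic_curvature//.
have truncated_mobius (c : R) : -1 < c -> affine_equiv (truncated_density c) f ->
    mobius_on (supp f) (cdf_of f).
  move=> c1; have [Dg sg _ FE] := truncated_law c1; apply: affine_equiv_mobius => //.
  exists (1 + c), 0, c, 1; split; first by rewrite mulr1 mul0r subr0 gt_eqF//; lra.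
  rewrite sg => x; rewrite /= in_itv/= => x01; split; last exact: FE.
  have : 0 < (1 + c) * x by [rewrite mulr_gt0; lra].
  by move=> p0; rewrite gt_eqF//; lra.
split; last first.
  case=> [|[|[|[c [c1]]]]].
  - by rewrite uniform_truncated; apply: truncated_mobius; lra.
  - have [Dg sg _ FE] := lomax_law; apply: affine_equiv_mobius => //.
    exists 1, 0, 1, 1; split; first by rewrite mulr1 mul0r subr0 oner_eq0.
    rewrite sg => x; rewrite /= in_itv/= andbT => x01.
    by split; [rewrite gt_eqF//; lra|exact: FE].
  - have [Dg sg _ FE] := reflected_lomax_law; apply: affine_equiv_mobius => //.
    exists 0, 1, (-1), 1; split; first by apply/eqP; lra.
    rewrite sg => x; rewrite /= in_itv/= => x01.
    by split; [rewrite gt_eqF//; lra|exact: FE].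
  - exact: truncated_mobius.
move=> [a [b [c [d [D0 T]]]]].
have T1 x : supp f x -> c * x + d != 0 /\ cdf_of f x / 1 = mobius a b c d x.
  by rewrite divr1; exact: T.
have D_gt0 : 0 < a * d - b * c := mobius_det_gt0 Df uniformizing_id T1.
have [a0|a0] := eqVneq a 0.
  right; right; left; have [Dg sg _ FE] := reflected_lomax_law.
  have c0 : c != 0 by apply: contra_neq D0 => ->; rewrite a0; ring.
  have b0 : b != 0 by apply: contra_neq D0 => ->; rewrite a0; ring.
  have s0 : 0 < - b / c.
    have -> : - b / c = (a * d - b * c) / c ^+ 2 by rewrite a0; field.
    by rewrite divr_gt0// exprn_even_gt0.
  apply: (affine_equiv_of_cdf (b := (b - d) / c) Df Dg s0) => x Ix.
  have [z0 Fx] := T x Ix; have := cdf_of_in01 Df Ix.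
  have yE : (x - (b - d) / c) / (- b / c) = 1 - (c * x + d) / b.
    by field; rewrite c0 b0.
  rewrite Fx /mobius a0 mul0r add0r yE => F01.
  have F01' : 1 < (b / (c * x + d))^-1 by rewrite invf_gt1; lra.
  rewrite FE; last by rewrite subr_lt0 -[_ / b]invf_div.
  have E1 (t : R) : -1 * (1 - t) + 1 = t by ring.
  by rewrite /mobius E1 mul0r add0r div1r invf_div.
have [ac|ac] := eqVneq a c.
  right; left; have [Dg sg _ FE] := lomax_law.
  have s0 : 0 < (d - b) / a.
    have -> : (d - b) / a = (a * d - b * c) / a ^+ 2 by rewrite -ac; field.
    by rewrite divr_gt0// exprn_even_gt0.
  have db : d - b != 0 by apply: contra_neq D0 => db; rewrite -ac; nra.
  apply: (affine_equiv_of_cdf (b := - b / a) Df Dg s0) => x Ix.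
  have [z0 Fx] := T x Ix; have := cdf_of_in01 Df Ix.
  have yE : (x - - b / a) / ((d - b) / a) = (a * x + b) / (d - b).
    by field; rewrite a0 db.
  rewrite Fx yE /mobius -ac in z0 *; set F := _ / (_ + d) => F01.
  have axE : a * x + b = F * (a * x + d) by rewrite /F divfK.
  clearbody F; have F1 : 1 - F != 0 by lra.
  (* The affine coordinate of x is a function of F alone. *)
  have yF : (a * x + b) / (d - b) = F / (1 - F).
    apply: (mulIf F1); rewrite divfK//; apply: (mulIf db).
    by rewrite mulrAC divfK//; lra.
  rewrite yF FE; last by rewrite divr_gt0//; lra.
  by rewrite /mobius; field; lra.
right; right; right.
have ac0 : a - c != 0 by rewrite subr_eq0.
(* For c != 0 the sign says that a / c is not in [0, 1]. *)
have aac : 0 < a * (a - c).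
  rewrite lt_neqAle eq_sym mulf_neq0//= leNgt; apply/negP => neg.
  have c0 : c != 0 by apply: contraTneq neg => ->; rewrite subr0; nra.
  have p01 : 0 < a / c < 1.
    have -> : a / c = a * c / c ^+ 2 by field.
    have c2 : 0 < c ^+ 2 by rewrite exprn_even_gt0.
    by rewrite divr_gt0 ?ltr_pdivrMr//; nra.
  have [x Ix Fx] := cdf_of_reach Df p01; have [z0 E] := T x Ix.
  by have := mobius_omits D0 c0 z0; rewrite -E Fx eqxx.
have k1 : -1 < c / (a - c).
  have -> : c / (a - c) = -1 + a * (a - c) / (a - c) ^+ 2 by field.
  by rewrite ltrDl divr_gt0// exprn_even_gt0.
exists (c / (a - c)); split=> //; have [Dg sg _ FE] := truncated_law k1.
have s0 : 0 < (a * d - b * c) / (a * (a - c)) by rewrite divr_gt0.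
apply: (affine_equiv_of_cdf (b := - b / a) Df Dg s0) => x Ix.
have [z0 Fx] := T x Ix; have := cdf_of_in01 Df Ix.
have yE : (x - - b / a) / ((a * d - b * c) / (a * (a - c))) =
    (a * x + b) * (a - c) / (a * d - b * c) by field; rewrite a0 ac0 D0.
rewrite Fx yE /mobius; set F := _ / (_ + d) => F01.
have axE : a * x + b = F * (c * x + d) by rewrite /F divfK.
clearbody F.
have w_gt0 : 0 < a * (a - c * F) by nra.
have w0 : a - c * F != 0 by apply: contraTneq w_gt0 => ->; rewrite mulr0 ltxx.
(* The affine coordinate of x is a function of F alone. *)
have yF : (a * x + b) * (a - c) / (a * d - b * c) = F * (a - c) / (a - c * F).
  have E : F * (a * d - b * c) = (a * x + b) * (a - c * F).
    have -> : F * (a * d - b * c) = a * (F * (c * x + d)) - F * c * (a * x + b).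
      ring.
    rewrite -axE; ring.
  apply: (mulIf D0); rewrite divfK//.
  have -> : F * (a - c) / (a - c * F) * (a * d - b * c) =
    (a - c) * (F * (a * d - b * c)) / (a - c * F) by ring.
  by rewrite E; field.
rewrite yF FE.
  rewrite /mobius.
  have -> : c / (a - c) * (F * (a - c) / (a - c * F)) + 1 = a / (a - c * F).
    by field; rewrite ac0 w0.
  have -> : (1 + c / (a - c)) * (F * (a - c) / (a - c * F)) + 0 =
      F * (a / (a - c * F)) by field; rewrite ac0 w0.
  by rewrite mulfK// mulf_neq0// invr_eq0.
have -> : F * (a - c) / (a - c * F) = F * (a * (a - c)) / (a * (a - c * F)).
  by field; rewrite a0 w0.
have h1 : 0 < F * (a * (a - c)) by rewrite mulr_gt0//; lra.
have h2 : 0 < a ^+ 2 * (1 - F) by rewrite mulr_gt0 ?exprn_even_gt0//; lra.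
by rewrite divr_gt0 ?ltr_pdivrMr//; lra.
Qed.

Lemma parabolic_members (g : R -> R) :
  g = @uniform_density R \/ g = @lomax_density R \/
  g = reflect (@lomax_density R) \/
  (exists c : R, -1 < c /\ g = truncated_density c) ->
  Dplus g /\ C3_on (supp g) g.
Proof.
have tr (c : R) : -1 < c ->
    Dplus (truncated_density c) /\ C3_on (supp (truncated_density c)) (truncated_density c).
  by move=> /truncated_law[D s C _]; rewrite s.
case=> [->|[->|[->|[c [c1 ->]]]]].
- by rewrite uniform_truncated; apply: tr; lra.
- by have [D s C _] := lomax_law; rewrite s.
- by have [D s C _] := reflected_lomax_law; rewrite s.
- exact: tr.
Qed.

End Classification.

(** * Supports and symmetric laws of the hyperbolic family *)

Section Hyperbolic.
Context {R : realType}.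
Implicit Types (f g G h : R -> R) (I : set R).
Local Notation tau := (tanh (pi / 2) : R).

Lemma tau_gt0 : 0 < tau.
Proof.
have -> : 0 = tanh 0 :> R by rewrite /tanh oppr0 subrr mul0r.
by rewrite tanh_lt divr_gt0// pi_gt0.
Qed.

(** An open set contains neither its infimum nor its supremum. *)
Lemma open_interval_cases I : open I -> is_interval I -> I !=set0 ->
  I <> setT -> bounded_interval_or_half_line I.
Proof.
move=> oI itvI [x0 Ix0] InT.
have noinf : has_lbound I -> ~ I (inf I).
  move=> lI /(open_neighbours oI)[e [e0 Ie _]].
  by have := ge_inf lI Ie; lra.
have nosup : has_ubound I -> ~ I (sup I).
  move=> uI /(open_neighbours oI)[e [e0 _ Ie]].
  by have := ub_le_sup uI Ie; lra.
have IE := (is_intervalP I).1 itvI; move: IE; rewrite /Rhull.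
case: asboolP => lI; [rewrite (asboolF (noinf lI))|];
  (case: asboolP => uI; [rewrite (asboolF (nosup uI))|]) => IE.
- left; exists (inf I), (sup I); split=> //.
  move: (inf I) (sup I) IE Ix0 => p q ->; rewrite /= in_itv/= => /andP[].
  exact: lt_trans.
- by right; exists (inf I); left.
- by right; exists (sup I); right.
- by case: InT; rewrite IE set_itvNyy.
Qed.

(** A Moebius map without pole on the line is affine, hence unbounded, whereas
the hyperbolic tangent is bounded by 1. *)
Lemma hyperbolic_supp f : Dplus f -> C3_on (supp f) f ->
  Rcurv_const f (2 * pi ^+ 2) -> bounded_interval_or_half_line (supp f).
Proof.
move=> Df C3f /(hyperbolic_curvature Df C3f)[a [b [c [d [D0 T]]]]].
have [oI itvI _ _ _] := Df.
apply: open_interval_cases => //; first exact: supp_nonempty.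
move=> IT; have {T} T x : c * x + d != 0 /\ mobius a b c d x < 1.
  have Ix : supp f x by rewrite IT.
  have [z0 E] := T x Ix; split=> //.
  by have := tanh_itv (pi * (cdf_of f x - 1 / 2)); rewrite E => /andP[].
have c0 : c = 0.
  apply/eqP; apply: contraT => c0; have [+ _] := T (- d / c).
  by rewrite mulrC divfK// addNr eqxx.
have d0 : d != 0 by have [+ _] := T 0; rewrite mulr0 add0r.
have a0 : a != 0 by apply: contra_neq D0 => ->; rewrite c0; ring.
have [_] := T ((2 * d - b) / a).
have aE : a * ((2 * d - b) / a) + b = 2 * d by field.
by rewrite /mobius c0 mul0r add0r aE mulfK//; lra.
Qed.

Lemma hyperbolic_density_law (m gamma : R) : 0 < gamma ->
  [/\ Dplus (hyperbolic_density m gamma),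
      supp (hyperbolic_density m gamma) =
        `]m - gamma * tau, m + gamma * tau[%classic,
      C3_on `]m - gamma * tau, m + gamma * tau[%classic
        (hyperbolic_density m gamma),
      Rcurv_const (hyperbolic_density m gamma) (2 * pi ^+ 2)
    & forall x, m - gamma * tau < x < m + gamma * tau ->
        cdf_of (hyperbolic_density m gamma) x =
        1 / 2 + artanh ((x - m) / gamma) / pi].
Proof.
move=> g0; set I := `]_, _[%classic.
have g0' : gamma != 0 by rewrite gt_eqF.
have t1 := tanh_itv (pi / 2 : R); have t0 := tau_gt0.
have inI x : I x <-> `|x - m| < gamma * tau.
  rewrite /I /= in_itv/= ltr_norml; split; lra.
have hE x : mobius 1 (- m) 0 gamma x = (x - m) / gamma.
  by rewrite /mobius mul1r mul0r add0r.
have [|||||||D s C Rc FE] := @hyperbolic_law R I (hyperbolic_density m gamma)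
  1 (- m) 0 gamma.
- exact: interval_open.
- exact: interval_is_interval.
- by rewrite mul1r mulr0 subr0.
- by move=> x _; rewrite mul0r add0r.
- move=> x /inI Ix; rewrite /hyperbolic_density Ix !mul1r mulr0 subr0 mul0r add0r.
  have : 0 < gamma ^+ 2 - (x - m) ^+ 2.
    have gt : gamma * tau < gamma by rewrite gtr_pMr//; lra.
    have /andP[] : - gamma < x - m < gamma by rewrite -ltr_norml; lra.
    rewrite subr_sqr => h1 h2; apply: mulr_gt0; lra.
  move=> /lt0r_neq0 q0; have := lt0r_neq0 (pi_gt0 R).
  by move: (pi : R) => P P0; field; rewrite g0' q0 P0.
- by move=> x /inI /negP nI; rewrite /hyperbolic_density (negbTE nI).
- apply/seteqP; split => [_ [x /inI Ix <-]|y].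
    rewrite /= in_itv/= hE -ltr_norml normrM normfV (gtr0_norm g0).
    by rewrite ltr_pdivrMr// mulrC.
  rewrite /= in_itv/= -ltr_norml => y1; exists (m + gamma * y).
    by apply/inI; rewrite addrC addKr normrM gtr0_norm// ltr_pM2l.
  by rewrite hE; field.
split=> // x xI; rewrite FE ?hE//.
Qed.

(** The density comes from the Moebius map
[tanh (pi / 2) * (x - t - 1) / (x - t + 1)], which sends [t] and infinity to the
two ends of the required image. *)
Lemma right_half_line_law (t : R) : exists f : R -> R,
  [/\ Dplus f, C3_on (supp f) f, Rcurv_const f (2 * pi ^+ 2)
    & supp f = `]t, +oo[%classic].
Proof.
have t1 := tanh_itv (pi / 2 : R); have t0 := tau_gt0.
set u := tau in t1 t0.
pose a := u; pose b := - (u * (t + 1)); pose c : R := 1; pose d := 1 - t.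
pose f x := if t < x then
  (a * d - b * c) / (pi * ((c * x + d) ^+ 2 - (a * x + b) ^+ 2)) else 0.
have [|||||||D s C Rc _] := @hyperbolic_law R `]t, +oo[%classic f a b c d.
- exact: interval_open.
- exact: interval_is_interval.
- by rewrite /a /b /c /d; lra.
- by move=> x; rewrite /= in_itv/= andbT /c /d => tx; rewrite gt_eqF//; lra.
- by move=> x; rewrite /= in_itv/= andbT /f => ->.
- by move=> x; rewrite /= in_itv/= andbT /f => /negP/negbTE ->.
- apply/seteqP; split => [_ [x + <-]|y]; rewrite /= !in_itv/= ?andbT -/u.
    move=> tx; have z0 : 0 < c * x + d by rewrite /c /d; lra.
    rewrite /mobius ltr_pdivlMr// ltr_pdivrMr//.
    have : 0 < u * (x - t) by rewrite mulr_gt0//; lra.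
    by rewrite /a /b /c /d; lra.
  move=> yu; exists (t + (u + y) / (u - y)).
    by rewrite /= in_itv/= andbT ltrDl divr_gt0//; lra.
  have uy : u - y != 0 by apply/eqP; lra.
  rewrite /mobius.
  have -> : a * (t + (u + y) / (u - y)) + b = 2 * u * y / (u - y).
    by rewrite /a /b; field.
  have -> : c * (t + (u + y) / (u - y)) + d = 2 * u / (u - y).
    by rewrite /c /d; field.
  by field; rewrite uy; lra.
by exists f; split=> //; rewrite s.
Qed.

(** The Moebius map is that of [right_half_line_law], conjugated by the
reflections [x |-> 2 t - x] and [y |-> - y]. *)
Lemma left_half_line_law (t : R) : exists f : R -> R,
  [/\ Dplus f, C3_on (supp f) f, Rcurv_const f (2 * pi ^+ 2)
    & supp f = `]-oo, t[%classic].
Proof.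
have t1 := tanh_itv (pi / 2 : R); have t0 := tau_gt0.
set u := tau in t1 t0.
pose a := u; pose b := u * (1 - t); pose c : R := -1; pose d := t + 1.
pose f x := if x < t then
  (a * d - b * c) / (pi * ((c * x + d) ^+ 2 - (a * x + b) ^+ 2)) else 0.
have [|||||||D s C Rc _] := @hyperbolic_law R `]-oo, t[%classic f a b c d.
- exact: interval_open.
- exact: interval_is_interval.
- by rewrite /a /b /c /d; lra.
- by move=> x; rewrite /= in_itv/= /c /d => tx; rewrite gt_eqF//; lra.
- by move=> x; rewrite /= in_itv/= /f => ->.
- by move=> x; rewrite /= in_itv/= /f => /negP/negbTE ->.
- apply/seteqP; split => [_ [x + <-]|y]; rewrite /= !in_itv/= -/u.
    move=> tx; have z0 : 0 < c * x + d by rewrite /c /d; lra.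
    rewrite /mobius ltr_pdivlMr// ltr_pdivrMr//.
    have : 0 < u * (t - x) by rewrite mulr_gt0//; lra.
    by rewrite /a /b /c /d; lra.
  move=> yu; exists (t - (u - y) / (u + y)).
    by rewrite /= in_itv/= gtrBl divr_gt0//; lra.
  have uy : u + y != 0 by apply/eqP; lra.
  rewrite /mobius.
  have -> : a * (t - (u - y) / (u + y)) + b = 2 * u * y / (u + y).
    by rewrite /a /b; field.
  have -> : c * (t - (u - y) / (u + y)) + d = 2 * u / (u + y).
    by rewrite /c /d; field.
  by field; rewrite uy; lra.
by exists f; split=> //; rewrite s.
Qed.

Lemma hyperbolic_supports I :
  (exists f : R -> R,
     [/\ Dplus f, C3_on (supp f) f, Rcurv_const f (2 * pi ^+ 2) & supp f = I]) <->
  bounded_interval_or_half_line I.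
Proof.
split=> [[f [Df C3f Rf <-]]|]; first exact: hyperbolic_supp.
case=> [[a [b [ab ->]]]|[a [->|->]]].
- have t0 := tau_gt0; set u := tau in t0.
  have g0 : 0 < (b - a) / (2 * u) by apply: divr_gt0; lra.
  have [D s C Rc _] := hyperbolic_density_law ((a + b) / 2) g0.
  exists (hyperbolic_density ((a + b) / 2) ((b - a) / (2 * u))).
  split=> //; first by rewrite s.
  have u0 : u != 0 by rewrite gt_eqF.
  have aE : (a + b) / 2 - (b - a) / (2 * u) * u = a by field.
  have bE : (a + b) / 2 + (b - a) / (2 * u) * u = b by field.
  by rewrite s -/u aE bE.
- exact: right_half_line_law.
- exact: left_half_line_law.
Qed.

(** The sum [s] of the two values is constant on the support, by
differentiation; as [u] and [s - u] both range over values of a distribution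
function when [u] ranges over [(0, 1)], the constant is 1. *)
Lemma symmetric_cdf f m : Dplus f -> symmetric_about m f ->
  forall x, supp f x -> supp f (2 * m - x) /\
    cdf_of f x + cdf_of f (2 * m - x) = 1.
Proof.
move=> Df sym; have [oI itvI _ _ _] := Df.
have fE x : f (2 * m - x) = f x.
  have -> : 2 * m - x = m - (x - m) by ring.
  by rewrite -sym; congr f; ring.
have refl x : supp f x -> supp f (2 * m - x) by rewrite /supp/= fE.
pose Phi x := cdf_of f x + cdf_of f (2 * m - x).
have dPhi x : supp f x -> is_derive x 1 Phi 0.
  move=> Ix; have dr : is_derive x 1 (fun y => 2 * m - y) (-1).
    have -> : (fun y => 2 * m - y) = (fun y => -1 * y + 2 * m).
      by apply/funext => y; ring.
    exact: is_derive_affine.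
  have d2 := is_derive_compr (g := fun y => 2 * m - y)
    (is_derive_cdf Df (refl x Ix)) dr.
  apply: (is_derive_to (is_deriveD (is_derive_cdf Df Ix) d2)).
  by rewrite fE; ring.
have [x0 Ix0] := supp_nonempty Df; set s := Phi x0.
have PhiE x : supp f x -> cdf_of f x + cdf_of f (2 * m - x) = s.
  by move=> Ix; exact: (derive0_constant itvI dPhi Ix Ix0).
suff s1 : s = 1 by move=> x Ix; rewrite PhiE//; split=> //; exact: refl.
apply/eqP; rewrite eq_le; apply/andP; split; rewrite leNgt; apply/negP => s1.
  have u01 : 0 < Num.min (1 / 2) ((s - 1) / 2) < 1.
    by rewrite lt_min gt_min; lra.
  have [x Ix Fx] := cdf_of_reach Df u01; have := PhiE x Ix.
  have := cdf_of_le1 Df (2 * m - x).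
  by have : cdf_of f x <= (s - 1) / 2 by [rewrite Fx ge_min lexx orbT]; lra.
have u01 : 0 < Num.max (1 / 2) ((s + 1) / 2) < 1.
  by rewrite lt_max gt_max; lra.
have [x Ix Fx] := cdf_of_reach Df u01; have := PhiE x Ix.
have := cdf_of_ge0 Df (2 * m - x).
by have : (s + 1) / 2 <= cdf_of f x by [rewrite Fx le_max lexx orbT]; lra.
Qed.

(** For a symmetric law, [h = tanh (pi (F - 1/2))] is odd about [m]; an odd
Moebius map without pole at [m] is affine, so [h = (x - m) / gamma], and the
image of [h] determines the support. *)
Lemma hyperbolic_symmetric f m :
  [/\ Dplus f, C3_on (supp f) f, Rcurv_const f (2 * pi ^+ 2)
    & symmetric_about m f] <->
  exists gamma : R, 0 < gamma /\ forall x, f x = hyperbolic_density m gamma x.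
Proof.
split=> [[Df C3f Rf sym]|[gamma [g0 /funext ->]]]; last first.
  have [D s C Rc _] := hyperbolic_density_law m g0; split=> //; first by rewrite s.
  move=> t; rewrite /hyperbolic_density.
  have -> : m + t - m = t by ring.
  have -> : m - t - m = - t by ring.
  by rewrite normrN sqrrN.
have [oI itvI _ _ _] := Df.
have := hyperbolic_curvature Df C3f; case=> /(_ Rf) [a [b [c [d [D0 T]]]]] _.
have D_gt0 := mobius_det_gt0 Df uniformizing_tanh T.
have symF := symmetric_cdf Df sym.
have Im : supp f m.
  have [x Ix] := supp_nonempty Df; have [Ix' _] := symF x Ix.
  have [xm|mx] := leP x m; [apply: (itvI x (2 * m - x))|
    apply: (itvI (2 * m - x) x)] => //; lra.
have oddT x : supp f x -> mobius a b c d (2 * m - x) = - mobius a b c d x.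
  move=> Ix; have [Ix' FF] := symF x Ix.
  have [_ <-] := T _ Ix'; have [_ <-] := T _ Ix.
  rewrite -tanhN; congr tanh.
  have -> : cdf_of f (2 * m - x) = 1 - cdf_of f x by lra.
  by lra.
have [e [e0 Ime Ipe]] := open_neighbours oI Im.
have am : a * m + b = 0.
  have [z0 _] := T m Im; have := oddT m Im.
  have -> : 2 * m - m = m by ring.
  move=> E; have {E} : mobius a b c d m = 0 by lra.
  by rewrite /mobius => /eqP; rewrite mulf_eq0 invr_eq0 (negbTE z0) orbF => /eqP.
have bE : b = - (a * m) by lra.
have a0 : a != 0 by apply: contra_neq D0 => a0; rewrite bE a0; ring.
(* Oddness at m + e reads a e / (z - c e) = a e / (z + c e), z = c m + d. *)
have c0 : c = 0.
  have := oddT _ Ipe; have [zp _] := T _ Ipe; have [zm _] := T _ Ime.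
  have -> : 2 * m - (m + e) = m - e by ring.
  rewrite /mobius bE => E.
  have {E} : a * (m - e) + - (a * m) = - (a * (m + e) + - (a * m)) *
      ((c * (m - e) + d) / (c * (m + e) + d)).
    apply: (mulIf (invr_neq0 zm)); rewrite E; field; by rewrite zp zm.
  move=> E; have {E} : 1 = (c * (m - e) + d) / (c * (m + e) + d).
    apply: (mulfI (mulf_neq0 a0 (lt0r_neq0 e0))); lra.
  move=> /(congr1 (fun y => y * (c * (m + e) + d))); rewrite divfK// mul1r => E.
  apply: (mulIf (lt0r_neq0 e0)); lra.
rewrite c0 mulr0 subr0 in D_gt0 D0.
have d0 : d != 0 by apply: contra_neq D0 => ->; rewrite mulr0.
exists (d / a); have g0 : 0 < d / a.
  have -> : d / a = a * d / a ^+ 2 by field.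
  by rewrite divr_gt0// exprn_even_gt0.
split=> //.
have hE x : mobius a b c d x = (x - m) / (d / a).
  by rewrite /mobius c0 bE mul0r add0r; field; rewrite a0 d0.
have [Dg sg Cg _ FgE] := hyperbolic_density_law m g0.
set gamma := d / a in g0 hE Dg sg Cg FgE *.
have TI x : supp f x -> tanh (pi * (cdf_of f x - 1 / 2)) = (x - m) / gamma.
  by move=> Ix; have [_ ->] := T x Ix.
have onto := tanh_phase_onto Df.
have IJ x : supp f x <-> m - gamma * tau < x < m + gamma * tau.
  have -> : (m - gamma * tau < x < m + gamma * tau) =
      (- tau < (x - m) / gamma < tau).
    by rewrite ltr_pdivlMr// ltr_pdivrMr//; lra.
  split=> [Ix|xJ].
    have : `]- tau, tau[%classic (tanh (pi * (cdf_of f x - 1 / 2))).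
      by rewrite -onto; exists x.
    by rewrite /= in_itv/= TI.
  have : `]- tau, tau[%classic ((x - m) / gamma) by rewrite /= in_itv.
  rewrite -onto => -[y Iy]; rewrite TI//.
  by move=> /(mulIf (invr_neq0 (lt0r_neq0 g0)))/addIr <-.
move=> x; have [Ix|nIx] := pselect (supp f x); last first.
  have -> : f x = 0 by apply/eqP; move: nIx => /negP; rewrite negbK.
  have : ~ supp (hyperbolic_density m gamma) x.
    by rewrite sg /= in_itv/= => /IJ.
  by rewrite /supp/= => /negP; rewrite negbK => /eqP.
have Igx : supp (hyperbolic_density m gamma) x.
  by rewrite sg /= in_itv/=; exact/IJ.
apply: (is_derive_locally_unique oI Ix _ (is_derive_cdf Df Ix)
  (is_derive_cdf Dg Igx)) => y Iy.
rewrite FgE; last exact/IJ.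
by rewrite -TI// tanhK [pi * _]mulrC mulfK ?gt_eqF ?pi_gt0// addrC subrK.
Qed.

End Hyperbolic.

(** * One-parameter subgroups of SL(2,R) *)

Section SL2.
Context {R : realType}.

Definition mx22 (a b c d : R) : 'M[R]_2 :=
  \matrix_(i, j) if i == 0 then if j == 0 then a else b
                 else if j == 0 then c else d.

Lemma det_mx22 a b c d : \det (mx22 a b c d) = a * d - b * c.
Proof.
rewrite (expand_det_row _ 0) !big_ord_recl big_ord0 addr0.
rewrite /cofactor !det_mx11 !mxE/=. 
rewrite expr0 expr1; ring.
Qed.

Lemma tr_mx22 a b c d : \tr (mx22 a b c d) = a + d.
Proof. by rewrite /mxtrace !big_ord_recl big_ord0 addr0 !mxE. Qed.

Lemma mul_mx22 a b c d a' b' c' d' :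
  mx22 a b c d *m mx22 a' b' c' d' =
  mx22 (a * a' + b * c') (a * b' + b * d') (c * a' + d * c') (c * b' + d * d').
Proof.
apply/matrixP => i j; rewrite !mxE !big_ord_recl big_ord0 addr0 !mxE/=.
by case: (i == 0); case: (j == 0).
Qed.

Lemma scalar_mx22 (x : R) : mx22 x 0 0 x = x%:M.
Proof.
apply/matrixP => i j; rewrite !mxE.
by case: i => [[|[|//]]] ?; case: j => [[|[|//]]] ?.
Qed.

Lemma one_parameter_mx22 (a b c d : R -> R) :
  (forall t, a t * d t - b t * c t = 1) ->
  (forall s t, mx22 (a (s + t)) (b (s + t)) (c (s + t)) (d (s + t)) =
     mx22 (a s) (b s) (c s) (d s) *m mx22 (a t) (b t) (c t) (d t)) ->
  continuous a -> continuous b -> continuous c -> continuous d ->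
  one_parameter_SL2 (fun t => mx22 (a t) (b t) (c t) (d t)).
Proof.
move=> D M ca cb cc cd; split=> //; first by move=> t; rewrite det_mx22.
move=> i j; have -> : (fun t => mx22 (a t) (b t) (c t) (d t) i j) =
    if i == 0 then if j == 0 then a else b else if j == 0 then c else d.
  by apply/funext => t; rewrite mxE; case: (i == 0); case: (j == 0).
by case: (i == 0); case: (j == 0).
Qed.

(** The subgroup is that of rotations, by the addition formulas. *)
Lemma tan_elliptic :
  uniformizes_class (@tan R) [set x | cos x != 0] elliptic.
Proof.
exists (fun t => mx22 (cos t) (sin t) (- sin t) (cos t)).
have cls t : sin t != 0 -> elliptic (mx22 (cos t) (sin t) (- sin t) (cos t)).
  rewrite /elliptic tr_mx22 => s0.
  have s2 : 0 < sin t ^+ 2 by rewrite exprn_even_gt0.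
  have := cos2Dsin2 t; rewrite ltr_norml => cs; apply/andP; split; nra.
split.
- apply: (one_parameter_mx22 (d := cos)).
  + by move=> t; rewrite mulrN opprK -!expr2 cos2Dsin2.
  + move=> s t; rewrite mul_mx22 cosD sinD; congr mx22; ring.
  + exact: continuous_cos.
  + exact: continuous_sin.
  + by move=> t; apply: continuousN; exact: continuous_sin.
  + exact: continuous_cos.
- by exists (pi / 2); apply: cls; rewrite sin_pihalf oner_eq0.
- move=> t; have [s0|s0] := eqVneq (sin t) 0; last by right; right; exact: cls.
  have /eqP := cos2Dsin2 t; rewrite s0 expr0n addr0 sqrf_eq1 => /orP[]/eqP ->.
    by left; rewrite oppr0 scalar_mx22.
  by right; left; rewrite oppr0 scalar_mx22 raddfN.
- move=> t x /= cx cxt; rewrite !mxE/=.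
  have zE : - sin t * tan x + cos t = cos (x + t) / cos x.
    by rewrite cosD /tan; field.
  split; first by rewrite zE mulf_neq0// invr_eq0.
  have nE : cos t * tan x + sin t = sin (x + t) / cos x.
    by rewrite sinD /tan; field.
  by rewrite /mobius zE nE {1}/tan; field; rewrite cx cxt.
Qed.

(** The subgroup is that of unipotent matrices. *)
Lemma id_parabolic : uniformizes_class (@id R) setT parabolic.
Proof.
exists (fun t => mx22 1 t 0 1).
have cls (t : R) : t != 0 -> parabolic (mx22 1 t 0 1).
  move=> t0; rewrite /parabolic tr_mx22; split; first by rewrite gtr0_norm//; lra.
  split=> /matrixP /(_ 0 1); rewrite !mxE/= => /eqP; rewrite ?oppr0 (negbTE t0)//.
split.
- apply: (one_parameter_mx22 (a := fun=> 1) (b := id) (c := fun=> 0) (d := fun=> 1)).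
  + by move=> t; ring.
  + by move=> s t; rewrite mul_mx22; congr mx22; ring.
  + by move=> t; exact: cvg_cst.
  + by move=> t; exact: cvg_id.
  + by move=> t; exact: cvg_cst.
  + by move=> t; exact: cvg_cst.
- by exists 1; apply: cls; rewrite oner_eq0.
- move=> t; have [->|t0] := eqVneq t 0; last by right; right; exact: cls.
  by left; rewrite scalar_mx22.
- move=> t x _ _; rewrite !mxE/= mul0r add0r oner_eq0; split=> //.
  by rewrite /mobius mul0r add0r divr1 mul1r.
Qed.

(** The subgroup is that of hyperbolic rotations, of trace [2 cosh t]. *)
Lemma tanh_hyperbolic : uniformizes_class (@tanh R) setT hyperbolic.
Proof.
pose ch (t : R) := (expR t + expR (- t)) / 2.
pose sh (t : R) := (expR t - expR (- t)) / 2.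
exists (fun t => mx22 (ch t) (sh t) (sh t) (ch t)).
have cls (t : R) : t != 0 -> hyperbolic (mx22 (ch t) (sh t) (sh t) (ch t)).
  move=> t0; rewrite /hyperbolic tr_mx22.
  have e0 := expR_gt0 t; have en0 := expR_gt0 (- t).
  have ee := expRxMexpNx_1 t.
  rewrite gtr0_norm /ch; last lra.
  have e1 : expR t != expR (- t).
    by apply/eqP => /expR_inj E; move/eqP: t0; apply; lra.
  have : 0 < (expR t - expR (- t)) ^+ 2 by rewrite exprn_even_gt0//= subr_eq0.
  nra.
have cexp : continuous (@expR R) by exact: continuous_expR.
have cexpN : continuous (fun t : R => expR (- t)).
  move=> t; have d := is_derive_compr (is_derive_expR _) (is_deriveN (is_derive_id t 1)).
  exact: is_derive_continuous d.
have cch : continuous ch.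
  by move=> t; apply: cvgM; [apply: cvgD; [exact: cexp|exact: cexpN]|exact: cvg_cst].
have csh : continuous sh.
  by move=> t; apply: cvgM; [apply: cvgB; [exact: cexp|exact: cexpN]|exact: cvg_cst].
split.
- apply: (one_parameter_mx22 (a := ch) (b := sh) (c := sh) (d := ch)) => //.
  + move=> t; have := expRxMexpNx_1 t; rewrite /ch /sh; lra.
  + by move=> s t; rewrite mul_mx22 /ch /sh opprD !expRD; congr mx22; field.
- by exists 1; apply: cls; rewrite oner_eq0.
- move=> t; have [->|t0] := eqVneq t 0; last by right; right; exact: cls.
  have E2 : (1 + 1) / 2 = 1 :> R by field.
  by left; rewrite /ch /sh oppr0 expR0 subrr mul0r E2 scalar_mx22.
- move=> t x _ _; rewrite !mxE/=.
  have p s : 0 < expR s + expR (- s) :> R by rewrite addr_gt0 ?expR_gt0.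
  have px := lt0r_neq0 (p x); have pxt := lt0r_neq0 (p (x + t)).
  have zE : sh t * tanh x + ch t =
      (expR (x + t) + expR (- (x + t))) / (expR x + expR (- x)).
    by rewrite /sh /ch /tanh opprD !expRD; field.
  have nE : ch t * tanh x + sh t =
      (expR (x + t) - expR (- (x + t))) / (expR x + expR (- x)).
    by rewrite /sh /ch /tanh opprD !expRD; field.
  split; first by rewrite zE mulf_neq0// invr_eq0.
  by rewrite /mobius zE nE {1}/tanh; field; rewrite px pxt.
Qed.

End SL2.

(** * The classification theorem *)

Unset Implicit Arguments.

Theorem theorem12 (R : realType) :
  (* the three solution families *)
  (forall f : R -> R, Dplus f -> C3_on (supp f) f ->
    let F := cdf_of f in
    let I := supp f in
    [/\ (* elliptic *)
        (Rcurv_const f (- (2 * pi ^+ 2)) <->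
           mobius_on I (fun x => tan (pi * (F x - 1 / 2)))) /\
        (mobius_on I (fun x => tan (pi * (F x - 1 / 2))) <->
           exists m gamma : R,
             0 < gamma /\ forall x, f x = cauchy_density m gamma x),
        (* parabolic *)
        (Rcurv_const f 0 <-> mobius_on I F) /\
        (mobius_on I F <->
           [/\ mobius_on I F, increasing_on I F & F @` I = `]0, 1[%classic])
      & (* hyperbolic *)
        (Rcurv_const f (2 * pi ^+ 2) <->
           mobius_on I (fun x => tanh (pi * (F x - 1 / 2)))) /\
        (mobius_on I (fun x => tanh (pi * (F x - 1 / 2))) <->
           exists h : R -> R,
             [/\ mobius_on I h,
                 h @` I = `]- tanh (pi / 2), tanh (pi / 2)[%classic
               & forall x, I x -> tanh (pi * (F x - 1 / 2)) = h x])]) /\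
  (* the Cauchy densities do belong to the class *)
  (forall m gamma : R, 0 < gamma ->
    Dplus (cauchy_density m gamma) /\
    C3_on (supp (cauchy_density m gamma)) (cauchy_density m gamma)) /\
  (* zero-curvature laws up to affine equivalence *)
  (forall f : R -> R, Dplus f -> C3_on (supp f) f ->
    (Rcurv_const f 0 <->
       affine_equiv uniform_density f \/
       affine_equiv lomax_density f \/
       affine_equiv (reflect lomax_density) f \/
       exists c : R, -1 < c /\ affine_equiv (truncated_density c) f)) /\
  (forall g : R -> R,
    g = uniform_density \/ g = lomax_density \/ g = reflect lomax_density \/
    (exists c : R, -1 < c /\ g = truncated_density c) ->
    Dplus g /\ C3_on (supp g) g) /\
  (* supports in the hyperbolic case *)
  (forall I : set R,
    (exists f : R -> R,
       [/\ Dplus f, C3_on (supp f) f, Rcurv_const f (2 * pi ^+ 2)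
         & supp f = I]) <->
    bounded_interval_or_half_line I) /\
  (* symmetric representatives in the hyperbolic case *)
  (forall (f : R -> R) (m : R),
    [/\ Dplus f, C3_on (supp f) f, Rcurv_const f (2 * pi ^+ 2)
      & symmetric_about m f] <->
    exists gamma : R,
      0 < gamma /\ forall x, f x = hyperbolic_density m gamma x) /\
  (* the classes of SL(2,R) *)
  [/\ uniformizes_class (@tan R) [set x | cos x != 0] elliptic,
      uniformizes_class (@id R) setT parabolic
    & uniformizes_class (@tanh R) setT hyperbolic].
Proof.
split=> [f Df C3f F I|].
  split; split.
  - exact: elliptic_curvature.
  - split; first exact: elliptic_cauchy.
    by case=> m [gamma [g0 fE]]; exact: cauchy_mobius g0 fE.
  - exact: parabolic_curvature.
  - split=> [h|[]//]; split=> //; first exact: cdf_of_increasing.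
    exact: cdf_of_onto.
  - exact: hyperbolic_curvature.
  - split=> [h|[h [hM _ hE]]].
      exists (fun x => tanh (pi * (F x - 1 / 2))); split=> //.
      exact: tanh_phase_onto.
    by apply: mobius_on_ext hM => x Ix; rewrite hE.
split=> [m gamma g0|]; first by have [D s C _] := cauchy_law m g0; rewrite s.
split; first exact: parabolic_classification.
split; first exact: parabolic_members.
split; first exact: hyperbolic_supports.
split; first exact: hyperbolic_symmetric.
by split; [exact: tan_elliptic|exact: id_parabolic|exact: tanh_hyperbolic].
Qed.
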